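(* Let $\Omega\subset\mathbb{R}^n$ be a bounded domain and $1<p<\infty$. Let $v$ be a weight on $\Omega$ with $v\in L^1(\Omega)$, let $Q$ be a measurable, symmetric, nonnegative definite $n\times n$ matrix function on $\Omega$ with $|Q(x)|_{\mathrm{op}}^{p/2}\le k\,v(x)$ for a.e. $x\in\Omega$ (some constant $k$), and let $\mathbf t\cdot\nabla$ be a degenerate subunit vector field on $\Omega$. Suppose that for some $\sigma>p$ the Sobolev inequality $$\|\varphi\|_{L^N(v,\Omega)}\le S_N\|\nabla\varphi\|_{QL^p(\Omega)}\qquad\text{for all }\varphi\in \mathrm{Lip}_0(\Omega)$$ holds with $N(t)=t^{p}\log(e+t)^\sigma$. Let $\alpha>\frac{p(p-1)}{\sigma}$ and $\beta>\frac{p}{\sigma-p}$, and let $f\in L^A(v,\Omega)$ and $g\in L^B(v,\Omega)$, where $$A(t)=\exp(t^\alpha)-1,\qquad B(t)=\exp(t^\beta)-1.$$ Then there is a constant $C$, depending only on $A,B,N,\mathbf t,p,S_N,\Omega,v$ (and in particular independent of $u,f,g$), such that every degenerate weak subsolution $u\in QH^{1,p}_0(v,\Omega)$ of the Dirichlet problem (D) (see context) satisfies $$\|u^+\|_{L^\infty(v,\Omega)}\le C\big(\|f\|_{L^A(v,\Omega)}+\|g\|_{L^B(v,\Omega)}\big),$$ and every degenerate weak supersolution $u\in QH^{1,p}_0(v,\Omega)$ of (D) satisfies the same bound with $u^-$ in place of $u^+$. In particular, if $u$ is a degenerate weak solution of (D), then $u\in L^\infty(v,\Omega)$ with this bound.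
   Context: A weight $v$ is a nonnegative measurable function; $v(E)=\int_E v\,dx$. $L^p(v,\Omega)$ is the Lebesgue space with respect to the measure $v\,dx$, and $\|\cdot\|_{L^\infty(v,\Omega)}$ is the essential supremum with respect to $v\,dx$. For an increasing function $\Phi:[0,\infty)\to[0,\infty)$ with $\Phi(0)=0$, $\|h\|_{L^\Phi(v,\Omega)}=\inf\{\lambda>0:\int_\Omega \Phi(|h|/\lambda)\,v\,dx\le 1\}$, and $L^\Phi(v,\Omega)$ is the set of measurable $h:\Omega\to\mathbb{R}$ for which this is finite. $\mathrm{Lip}_0(\Omega)$ is the set of locally Lipschitz functions with compact support in $\Omega$. $QL^p(\Omega)$ is the space of measurable $\mathbf g:\Omega\to\mathbb{R}^n$ with $\|\mathbf g\|_{QL^p(\Omega)}=(\int_\Omega|\sqrt{Q}\,\mathbf g|^p\,dx)^{1/p}<\infty$, with functions identified when their difference has norm $0$. $QH^{1,p}_0(v,\Omega)$ is the completion of $\mathrm{Lip}_0(\Omega)$ in the norm $\|\psi\|_{L^p(v,\Omega)}+\|\nabla\psi\|_{QL^p(\Omega)}$; its elements are identified with pairs $(u,\nabla u)\in L^p(v,\Omega)\times QL^p(\Omega)$ that are limits in $L^p(v,\Omega)\times QL^p(\Omega)$ of sequences $(\psi_j,\nabla\psi_j)$ with $\psi_j\in\mathrm{Lip}_0(\Omega)$. Here ''$\nabla u$'' is notation for the second component (it need not be a classical weak gradient), and one writes $u\in QH^{1,p}_0(v,\Omega)$ for the pair. For measurable $\mathbf t:\Omega\to\mathbb{R}^n$,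 $\mathbf t\cdot\nabla$ is a degenerate subunit vector field if there is a constant $C(\mathbf t)>0$ with $\|\mathbf t\cdot\nabla\varphi\|_{L^p(v,\Omega)}\le C(\mathbf t)\|\nabla\varphi\|_{QL^p(\Omega)}$ for every $\varphi\in\mathrm{Lip}_0(\Omega)$. Dependence of a constant on $\mathbf t$ includes dependence on $C(\mathbf t)$. The Dirichlet problem (D) is, formally, $$-v^{-1}\mathrm{div}(|\sqrt Q\nabla u|^{p-2}Q\nabla u)=f|f|^{p-2}-v^{-1}\mathrm{div}(v|g|^{p-2}g\,\mathbf t)\ \text{in }\Omega,\qquad u=0\text{ on }\partial\Omega,$$ with $f,g$ real-valued measurable functions. A pair $(u,\nabla u)\in QH^{1,p}_0(v,\Omega)$ is a degenerate weak solution of (D) if $$\int_\Omega|\sqrt Q\nabla u|^{p-2}\,\nabla\varphi\cdot Q\nabla u\,dx=\int_\Omega\big(f|f|^{p-2}\varphi+|g|^{p-2}g\,\mathbf t\cdot\nabla\varphi\big)\,v\,dx$$ for every $\varphi\in\mathrm{Lip}_0(\Omega)$. It is a degenerate weak subsolution (supersolution) if this holds with ''$=$'' replaced by ''$\le$'' (''$\ge$'') for every nonnegative $\varphi\in\mathrm{Lip}_0(\Omega)$. Expressions $|w|^{p-2}w$ are $0$ where $w=0$. Finally $u^+=\max(u,0)$, $u^-=\max(-u,0)$. *)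

(* Defs.v *)
From HB Require Import structures.
From mathcomp Require Import all_boot all_order all_algebra.
From mathcomp Require Import all_classical all_reals all_analysis.
From mathcomp Require Import measurable_realfun.

Set Implicit Arguments.
Unset Strict Implicit.
Unset Printing Implicit Defensive.

Import Order.TTheory GRing.Theory Num.Theory.
Import numFieldNormedType.Exports.

Local Open Scope classical_set_scope.
Local Open Scope ring_scope.

Section lebesgue_measure_on_row_vectors.
Context (R : realType) (n : nat).
Implicit Types (a b : 'rV[R]_n.+1) (X : set 'rV[R]_n.+1).

Definition box a b : set 'rV[R]_n.+1 :=
  [set x | forall i, a 0 i < x 0 i <= b 0 i].

(* The factors are truncated at 0, so that empty boxes have volume 0. *)
Definition box_volume a b : \bar R :=
  (\prod_(i < n.+1) Num.max 0 (b 0 i - a 0 i))%:E.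

Definition box_cover X : set (nat -> 'rV[R]_n.+1 * 'rV[R]_n.+1) :=
  [set c | X `<=` \bigcup_k box (c k).1 (c k).2].

Definition leb X : \bar R :=
  ereal_inf [set (\sum_(k <oo) box_volume (c k).1 (c k).2)%E | c in box_cover X].

Lemma box_volume_ge0 a b : (0 <= box_volume a b)%E.
Proof.
by rewrite lee_fin; apply: prodr_ge0 => i _; rewrite le_max lexx.
Qed.

Lemma leb_ge0 X : (0 <= leb X)%E.
Proof.
apply: le_ereal_inf_tmp => _ [c _ <-].
by apply: nneseries_ge0 => k _ _; exact: box_volume_ge0.
Qed.

Lemma le_leb : {homo leb : A B / A `<=` B >-> (A <= B)%E}.
Proof.
move=> A B AB; apply/ereal_inf_le_tmp => x [c cB <-].
by exists c => //; exact: subset_trans AB cB.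
Qed.

Lemma leb0 : leb set0 = 0%E.
Proof.
apply/eqP; rewrite eq_le leb_ge0 andbT; apply: ereal_inf_lbound.
exists (fun=> (0, 0)); first exact: sub0set.
apply: eseries0 => k _ _ /=; rewrite /box_volume big_ord_recl !mxE subrr.
by rewrite maxxx mul0r.
Qed.

Lemma leb_sigma_subadditive : sigma_subadditive leb.
Proof.
move=> A; have [[i ioo]|] := pselect (exists i, leb (A i) = +oo%E).
  rewrite (eseries_pinfty _ _ ioo) ?leey// => k _.
  by rewrite -ltNye (lt_le_trans _ (leb_ge0 _)).
rewrite -forallNE => Aoo.
suff add2e (e : {posnum R}) :
    (leb (\bigcup_k A k) <= \sum_(i <oo) leb (A i) + e%:num%:E)%E.
  by apply/lee_addgt0Pr => _/posnumP[].
rewrite (le_trans _ (epsilon_trick _ _ _))//; last first.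
  by move=> k; exact: leb_ge0.
pose vol (c : 'rV[R]_n.+1 * 'rV[R]_n.+1) := box_volume c.1 c.2.
have vol_ge0 c : (0 <= vol c)%E by exact: box_volume_ge0.
pose P k (c : nat -> 'rV[R]_n.+1 * 'rV[R]_n.+1) := box_cover (A k) c /\
  (\sum_(j <oo) vol (c j) <= leb (A k) + (e%:num / (2 ^ k.+1)%:R)%:E)%E.
have [G PG] : {G : nat -> nat -> 'rV[R]_n.+1 * 'rV[R]_n.+1 & forall k, P k (G k)}.
  apply: (@choice _ _ P) => k; rewrite /P /leb.
  set S := (X in ereal_inf X); move infS : (ereal_inf S) => iS.
  case: iS infS => [r Sr|Soo|Soo].
  - have ek : 0 < e%:num / (2 ^ k.+1)%:R by [].
    have /(lb_ereal_inf_adherent ek) : ereal_inf S \is a fin_num by rewrite Sr.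
    move=> [x [c Ac <-] xS].
    by exists c; split => //; rewrite -Sr; exact/ltW.
  - by have := Aoo k; rewrite /leb Soo.
  - suff : lbound S 0%E by move/le_ereal_inf_tmp; rewrite Soo.
    by move=> /= _ [c Ac <-]; apply: nneseries_ge0 => j _ _; exact: vol_ge0.
have volG_ge0 x : (0 <= (vol \o uncurry G) x)%E by exact: vol_ge0.
apply: (@le_trans _ _ (\esum_(i in setT) (vol \o uncurry G) i)%E).
  apply: ereal_inf_lbound => /=.
  have /card_esym/ppcard_eqP[f] := card_nat2.
  exists (uncurry G \o f).
    move=> t [k _ /(PG k).1 [j _ Gkj]].
    by exists (f^-1%FUN (k, j)) => //=; rewrite invK ?inE.
  rewrite -(esum_pred_image (vol \o uncurry G) _ xpredT) ?[fun=> _]set_true//.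
  by rewrite image_eq.
rewrite (_ : esum _ _ = \sum_(i <oo) \sum_(j <oo ) vol (G i j))%E; last first.
  pose J : nat -> set (nat * nat) := fun i => [set (i, j) | j in setT].
  rewrite (_ : setT = \bigcup_k J k); last first.
    by rewrite predeqE => -[k j]; split => // _; exists k => //; exists j.
  rewrite esum_bigcupT /=; last 2 first.
    - apply/trivIsetP => i j _ _ ij.
      rewrite predeqE => -[k m] /=; split => //= -[] [_] _ [<-{k} _].
      by move=> [m' _] [] /esym/eqP; rewrite (negbTE ij).
    - by move=> /= [k m]; exact: vol_ge0.
  rewrite -(image_id [set: nat]) -fun_true esum_pred_image//; last first.
    by move=> k _; exact: esum_ge0.
  apply: eq_eseriesr => /= j _.
  rewrite -(esum_pred_image (vol \o uncurry G) (pair j) predT)//=; last first.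
    by move=> ? ? _ _; exact: (@can_inj _ _ _ snd).
  by congr esum; rewrite predeqE => -[a b]; split; move=> [i _ <-]; exists i.
apply: lee_lim.
- apply: is_cvg_nneseries => k *.
  by apply: nneseries_ge0 => m *; exact: (volG_ge0 (k, m)).
- by apply: is_cvg_nneseries => k *; apply: adde_ge0 => //; exact: leb_ge0.
- by near=> k; apply: lee_sum => i _; exact: (PG i).2.
Unshelve. all: by end_near. Qed.

HB.instance Definition _ :=
  isOuterMeasure.Build R _ leb leb0 leb_ge0 le_leb leb_sigma_subadditive.

(* From here on, [measurable] on ['rV[R]_n.+1] is Lebesgue measurability
   (Caratheodory measurability for the outer measure above), and [leb] is the
   n.+1-dimensional Lebesgue measure on that complete sigma-algebra. *)
HB.instance Definition _ := @isMeasurable.Build (caratheodory_display leb)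
  'rV[R]_n.+1 leb.-caratheodory
  (caratheodory_measurable_set0 leb)
  (@caratheodory_measurable_setC _ _ leb)
  (@caratheodory_measurable_bigcup _ _ leb).

HB.instance Definition _ := isMeasure.Build _ 'rV[R]_n.+1 R leb
  leb0 leb_ge0 (@caratheodory_measure_sigma_additive _ _ leb).

End lebesgue_measure_on_row_vectors.
Arguments leb {R n} X.

Section linear_algebra.
Context (R : realType) (m : nat).
Implicit Types (x y : 'rV[R]_m) (A B : 'M[R]_m).

Definition dot x y : R := \sum_(i < m) x 0 i * y 0 i.

(* The library norm on ['rV] is the sup norm. *)
Definition enorm x : R := Num.sqrt (dot x x).

(* Vectors are rows, so this is the transpose of the column A x^T. *)
Definition mxact A x : 'rV[R]_m := x *m A^T.

Definition opnorm A : R :=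
  sup [set enorm (mxact A x) | x in [set x | enorm x <= 1]].

Definition sym_nonneg A : Prop :=
  A^T = A /\ forall x, 0 <= dot x (mxact A x).

(* The nonnegative definite square root, unique when it exists. *)
Definition sqrtmx A : 'M[R]_m :=
  xget 0 [set B | sym_nonneg B /\ B *m B = A].

End linear_algebra.

(* Functions on Omega are total functions whose values off Omega are never
   used; elements of Lip0 are extended by 0. *)
Section function_spaces.
Context (R : realType) (n : nat).
Local Notation V := 'rV[R]_n.+1.
Implicit Types (Omega : set V) (v h u phi : V -> R) (G t : V -> V).
Implicit Types (Q : V -> 'M[R]_n.+1).

Definition bounded_domain Omega : Prop :=
  [/\ open Omega, connected Omega, Omega !=set0 & bounded_set Omega].

Definition measurable_vf Omega G : Prop :=
  forall i, measurable_fun Omega (fun x => G x 0 i).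

Definition measurable_mxf Omega Q : Prop :=
  forall i j, measurable_fun Omega (fun x => Q x i j).

Definition weight Omega v : Prop :=
  measurable_fun Omega v /\ forall x, Omega x -> 0 <= v x.

(* The measure v dx on Omega: E |-> \int_(Omega `&` E) v dx. *)
Definition wmeas Omega v : set V -> \bar R :=
  fun E => (\int[leb]_(x in Omega `&` E) (v x)%:E)%E.

Definition Lp_norm Omega v (p : R) h : \bar R :=
  ((\int[leb]_(x in Omega) (`|h x| `^ p * v x)%:E) `^ p^-1)%E.

Definition in_Lp Omega v p h : Prop :=
  measurable_fun Omega h /\ (Lp_norm Omega v p h < +oo)%E.

(* Restricting to M >= 0 only matters when v dx is the zero measure. *)
Definition Linfty_norm Omega v h : \bar R :=
  ereal_inf [set M | (0 <= M)%E /\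
    {ae wmeas Omega v, forall x, Omega x -> (`|h x|%:E <= M)%E}].

Definition in_Linfty Omega v h : Prop :=
  measurable_fun Omega h /\ (Linfty_norm Omega v h < +oo)%E.

Definition Orlicz_norm Omega v (Phi : R -> R) h : \bar R :=
  ereal_inf [set lam%:E | lam in [set lam : R | 0 < lam /\
    (\int[leb]_(x in Omega) (Phi (`|h x| / lam) * v x)%:E <= 1)%E]].

Definition in_Orlicz Omega v Phi h : Prop :=
  measurable_fun Omega h /\ (Orlicz_norm Omega v Phi h < +oo)%E.

Definition QLp_norm Omega Q (p : R) G : \bar R :=
  ((\int[leb]_(x in Omega) (enorm (mxact (sqrtmx (Q x)) (G x)) `^ p)%:E)
     `^ p^-1)%E.

Definition in_QLp Omega Q p G : Prop :=
  measurable_vf Omega G /\ (QLp_norm Omega Q p G < +oo)%E.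

Definition locally_lipschitz Omega phi : Prop :=
  forall x, Omega x ->
    exists k : R, exists2 U : set V, nbhs x U & k.-lipschitz_U phi.

Definition Lip0 Omega : set (V -> R) :=
  [set phi | [/\ locally_lipschitz Omega phi,
    compact (closure [set x | phi x != 0]) &
    closure [set x | phi x != 0] `<=` Omega]].

(* The partial derivatives of a locally Lipschitz function exist almost
   everywhere; where one does not, ['D] takes an arbitrary value. *)
Definition grad phi : V -> V :=
  fun x => \row_(i < n.+1) 'D_(delta_mx 0 i) phi x.

(* (u, G) represents an element of QH^{1,p}_0(v,Omega), with G in the role of
   the gradient of u. *)
Definition QH0 Omega v Q (p : R) u G : Prop :=
  [/\ in_Lp Omega v p u, in_QLp Omega Q p G &
    exists psi : nat -> V -> R,
      [/\ forall j, Lip0 Omega (psi j),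
          Lp_norm Omega v p (fun x => psi j x - u x) @[j --> \oo] --> 0%E &
          QLp_norm Omega Q p (fun x => grad (psi j) x - G x) @[j --> \oo]
            --> 0%E]].

Definition subunit Omega v Q (p : R) t (Ct : R) : Prop :=
  [/\ measurable_vf Omega t, 0 < Ct & forall phi, Lip0 Omega phi ->
    (Lp_norm Omega v p (fun x => dot (t x) (grad phi x))
       <= Ct%:E * QLp_norm Omega Q p (grad phi))%E].

Definition sobolev Omega v Q (p : R) (Phi : R -> R) (S : R) : Prop :=
  forall phi, Lip0 Omega phi ->
    (Orlicz_norm Omega v Phi phi <= S%:E * QLp_norm Omega Q p (grad phi))%E.

End function_spaces.

Section dirichlet_problem.
Context (R : realType) (n : nat).
Local Notation V := 'rV[R]_n.+1.
Context (Omega : set V) (p : R) (v : V -> R) (Q : V -> 'M[R]_n.+1).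
Context (t : V -> V) (f g : V -> R).
Implicit Types (u phi : V -> R) (G : V -> V).

Definition pow_sign (w : R) : R := `|w| `^ (p - 2) * w.

(* When sqrt(Q) G = 0 and p = 2 the first factor is 0 `^ 0 = 1, but then
   Q G = 0 as well. *)
Definition energy_form G phi : \bar R :=
  (\int[leb]_(x in Omega)
    (enorm (mxact (sqrtmx (Q x)) (G x)) `^ (p - 2)
       * dot (grad phi x) (mxact (Q x) (G x)))%:E)%E.

Definition data_form phi : \bar R :=
  (\int[leb]_(x in Omega)
    ((pow_sign (f x) * phi x
        + pow_sign (g x) * dot (t x) (grad phi x)) * v x)%:E)%E.

Definition weak_solution u G : Prop :=
  QH0 Omega v Q p u G /\
  forall phi, Lip0 Omega phi -> energy_form G phi = data_form phi.

Definition weak_subsolution u G : Prop :=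
  QH0 Omega v Q p u G /\
  forall phi, Lip0 Omega phi -> (forall x, 0 <= phi x) ->
    (energy_form G phi <= data_form phi)%E.

Definition weak_supersolution u G : Prop :=
  QH0 Omega v Q p u G /\
  forall phi, Lip0 Omega phi -> (forall x, 0 <= phi x) ->
    (data_form phi <= energy_form G phi)%E.

End dirichlet_problem.

Definition log_bump (R : realType) (p sigma x : R) : R :=
  x `^ p * ln (expR 1 + x) `^ sigma.

Definition exp_bump (R : realType) (a x : R) : R := expR (x `^ a) - 1.

(* Main.v *)
Require Import Defs.
From HB Require Import structures.
From mathcomp Require Import all_boot all_order all_algebra.
From mathcomp Require Import all_classical all_reals all_analysis.
From mathcomp Require Import measurable_realfun.
From mathcomp Require complex.
From mathcomp Require Import ring lra.

Set Implicit Arguments.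
Unset Strict Implicit.
Unset Printing Implicit Defensive.

Import Order.TTheory GRing.Theory Num.Theory.
Import numFieldNormedType.Exports.

Local Open Scope classical_set_scope.
Local Open Scope ring_scope.

(* De Giorgi's method. Testing the inequality with [(psi - k)^+], where [psi] in
   Lip0 is close to [(u, G)], bounds the energy [E] of the truncation by
   [kappa = M z^(1/beta) exp (-2 z)] as soon as the level set has measure at most
   [m exp (-2 p z)]: the exponential integrability of [f] and [g] controls the
   right-hand side on small sets. The logarithmic Sobolev inequality gains a
   further factor [z^(-sigma/p)], so that the measure of the level set drops to
   [m exp (-2 p (z+1))] at the cost of raising the level by a multiple of
   [M z^(-theta)], with [theta = sigma/p - 1/beta > 1]; these increments are
   summable over the integers [z]. All estimates are made on [psi] and only the
   measures of level sets pass to the limit. No theorem on differentiability of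
   Lipschitz functions enters: since ['D] is [0] where a derivative does not
   exist, the gradient of [(psi - k)^+] is that of [psi] on [psi > k] and [0]
   elsewhere, at every point. *)

(** * Square roots of nonnegative matrices *)

(** The component [G] is not tied to [u] by a chain rule, so the pair itself is never truncated. On
    [psi > k], pairing with [G] instead of [grad psi] costs an error controlled by [grad psi - G],
    which drops below [kappa] from an index on that depends on [k] and [z]; hence the limit is taken
    at every step and not once at the end. The doubled rate [exp (-2 p z)] leaves room: where a
    rescaled truncation is at most [exp z], its [p]-th power integral is of order
    [exp (p z) exp (-2 p z) = exp (- p z)], less than the logarithmic gain [z^(-sigma)]. Chebyshev
    compares [exp (-2 z)] with [exp (-2 (z+1))], so a step costs only the factor [exp 2]. The
    thresholds have different roles. The one on [alpha] says [(p-1)/alpha < sigma/p]: the Sobolev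
    gain on the test function pays for the growth of [f]. The gradient term with [g] has no such
    gain, so [beta] fixes the size of [kappa], and [theta > 1] is exactly the condition
    [beta > p/(sigma-p)]. Constants are produced before [Q], [f], [g], [u] and [psi] are introduced;
    the energy of [G] enters only through its finiteness. *)

Lemma poly_interpolation (F : fieldType) (s : seq F) (h : F -> F) :
  exists p : {poly F}, forall x, x \in s -> p.[x] = h x.
Proof.
elim: s => [|a s [p ps]]; first by exists 0.
have [as_|as_] := boolP (a \in s).
  by exists p => x; rewrite inE => /predU1P[->|]; exact: ps.
pose w : {poly F} := \prod_(b <- s) ('X - b%:P).
have wa : w.[a] != 0 by rewrite -[_ == 0]/(root w a) root_prod_XsubC.
exists (p + ((h a - p.[a]) / w.[a]) *: w) => x.
rewrite inE hornerD hornerZ => /predU1P[->|xs].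
  by rewrite mulfVK// addrC subrK.
have /eqP -> : w.[x] == 0 by rewrite -[_ == 0]/(root w x) root_prod_XsubC.
by rewrite mulr0 addr0 ps.
Qed.

Section matrix_square_root.
Context (R : realType) (n : nat).
Implicit Types (A B : 'M[R]_n.+1) (x y z : 'rV[R]_n.+1).

Lemma dotE x y : dot x y = (x *m y^T) 0 0.
Proof. by rewrite !mxE; apply: eq_bigr => i _; rewrite !mxE. Qed.

Lemma dotC x y : dot x y = dot y x.
Proof. by apply: eq_bigr => i _; rewrite mulrC. Qed.

Lemma dot_mulmxr A x y : dot x (y *m A) = dot (x *m A^T) y.
Proof. by rewrite !dotE trmx_mul mulmxA. Qed.

Lemma dotBl x y z : dot (x - y) z = dot x z - dot y z.
Proof. by rewrite /dot -sumrB; apply: eq_bigr => i _; rewrite !mxE mulrBl. Qed.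

Lemma dotZl (a : R) x y : dot (a *: x) y = a * dot x y.
Proof. by rewrite /dot mulr_sumr; apply: eq_bigr => i _; rewrite !mxE mulrA. Qed.

Lemma dotNl x y : dot (- x) y = - dot x y.
Proof. by rewrite -scaleN1r dotZl mulN1r. Qed.

Lemma dotNr x y : dot x (- y) = - dot x y.
Proof. by rewrite dotC dotNl dotC. Qed.

Lemma dot0l x : dot 0 x = 0.
Proof. by rewrite -(scale0r 0) dotZl mul0r. Qed.

Lemma dot_ge0 x : 0 <= dot x x.
Proof. by apply: sumr_ge0 => i _; rewrite -expr2 sqr_ge0. Qed.

Lemma dot_eq0 x : dot x x = 0 -> x = 0.
Proof.
move=> /eqP; rewrite psumr_eq0 => [/allP x0|i _]; last by rewrite -expr2 sqr_ge0.
apply/rowP => i; rewrite mxE; apply/eqP.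
by have := x0 i (mem_index_enum _); rewrite /= mulf_eq0 orbb.
Qed.

Import complex.

(** [A] is Hermitian as a complex matrix, so the spectral theorem for normal matrices applies and
    the eigenvalues are real. The change of basis [P] stays complex; only the eigenvalues are
    brought back to [R]. *)
Lemma symmetric_real_diagonalization A : A^T = A ->
  exists (P : 'M[R[i]]_n.+1) (d : 'rV[R]_n.+1), P \in unitmx /\
    map_mx (real_complex R) A
      = conjmx (invmx P) (diag_mx (map_mx (real_complex R) d)).
Proof.
move=> symA; pose f := real_complex R; pose Ac := map_mx f A.
have realf a : f a \is Num.real by rewrite complex_real.
have herm : Ac \is hermsymmx.
  apply: realsym_hermsym; last by apply/mxOverP => i j; rewrite mxE realf.
  apply/is_hermitianmxP; rewrite expr0 scale1r map_mx_id//.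
  by rewrite /Ac map_trmx symA.
have := hermitian_spectral_diag_real herm.
have /orthomx_spectralP := hermitian_normalmx herm.
have := spectral_unit Ac.
move: (spectralmx Ac) (spectral_diag Ac) => P D Pu AE /mxOverP Dreal.
have [d dE] : exists d : 'rV[R]_n.+1, D = map_mx f d.
  exists (\row_j complex.Re (D 0 j)); apply/rowP => j; rewrite !mxE.
  by have /complex_realP[r ->] := Dreal 0 j.
exists P, d; split => //.
by rewrite -dE conjumx ?unitmx_inv// invmxK -/f -/Ac.
Qed.

(* The root is [(q A)^2] with [q] a real polynomial taking the value
   [lambda^(1/4)] at each eigenvalue [lambda] of [A]. *)
Lemma sym_nonneg_sqrt A : sym_nonneg A -> exists B, sym_nonneg B /\ B *m B = A.
Proof.
move=> [symA posA]; have [P [d [Pu AE]]] := symmetric_real_diagonalization symA.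
pose f := real_complex R.
(* [d 0 i] is a root of the characteristic polynomial of the real matrix [A], hence has a real
   eigenvector, on which the form of [A] is [d 0 i] times a positive number. *)
have d_ge0 i : 0 <= d 0 i.
  have : eigenvalue A (d 0 i).
    rewrite eigenvalue_root_char -(fmorph_root f).
    rewrite map_char_poly -/f AE -eigenvalue_root_char.
    apply/eigenvalueP; exists (row i P).
      rewrite conjumx ?unitmx_inv// invmxK !mulmxA -row_mul mulmxV//.
      by rewrite -row_mul mul1mx row_diag_mx -scalemxAl -rowE mxE.
    apply: contraTneq Pu => Pi; rewrite unitmxE unitfE negbK.
    apply/eqP; rewrite (expand_det_row _ i) big1// => j _.
    by move/rowP : Pi => /(_ j); rewrite !mxE => ->; rewrite mul0r.
  move=> /eigenvalueP[x xA x0].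
  have := posA x; rewrite /mxact symA xA dotC dotZl pmulr_lge0//.
  by rewrite lt_neqAle dot_ge0 andbT; apply: contra_neq x0 => /esym/dot_eq0.
have [q qd] := poly_interpolation [seq d 0 i | i <- enum 'I_n.+1]
  (fun a => Num.sqrt (Num.sqrt a)).
have qdE i : q.[d 0 i] ^+ 4 = d 0 i.
  rewrite qd ?map_f ?mem_enum// (exprM _ 2 2) sqr_sqrtr ?sqrtr_ge0//.
  by rewrite sqr_sqrtr.
pose C := horner_mx A q.
have symC : C^T = C.
  rewrite /C; elim/poly_ind : q {qd qdE C} => [|q c ih].
    by rewrite rmorph0 trmx0.
  rewrite rmorphD rmorphM /= horner_mx_X horner_mx_C linearD /= tr_scalar_mx.
  by rewrite trmx_mul ih symA; congr (_ + _); exact: comm_mx_horner.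
have C4 : C ^+ 4 = A.
  apply: (@map_mx_inj _ _ f); rewrite -rmorphXn /=.
  rewrite map_horner_mx -/f AE conjumx ?unitmx_inv//.
  rewrite horner_mx_uconj ?unitmx_inv//; congr (_ *m _ *m _); rewrite horner_mx_diag; congr diag_mx.
  by apply/rowP => i; rewrite !mxE horner_map /= horner_exp qdE.
(* Being the square of a symmetric matrix, the root has a form equal to a sum of squares; this is
   why fourth roots are interpolated. *)
exists (C *m C); split; last by rewrite -C4 !exprS expr0 mulr1 -!mulmxA.
split; first by rewrite trmx_mul symC.
by move=> x; rewrite /mxact trmx_mul symC mulmxA dot_mulmxr symC dot_ge0.
Qed.

Lemma dot_CauchySchwarz x y : dot x y ^+ 2 <= dot x x * dot y y.
Proof.
have [y0|y0] := eqVneq (dot y y) 0.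
  by rewrite (dot_eq0 y0) dotC !dot0l mulr0 expr0n.
have yy : 0 < dot y y by rewrite lt_neqAle eq_sym y0 dot_ge0.
pose a := dot x y / dot y y.
have := dot_ge0 (x - a *: y).
have -> : dot (x - a *: y) (x - a *: y)
    = dot x x - dot x y ^+ 2 / dot y y.
  rewrite dotBl dotZl !(dotC _ (x - _)) !dotBl !dotZl (dotC y x) /a.
  by field.
by rewrite subr_ge0 ler_pdivrMr.
Qed.

Lemma normr_dot_le x y : `|dot x y| <= enorm x * enorm y.
Proof.
rewrite -sqrtrM ?dot_ge0// -sqrtr_sqr.
by rewrite ler_sqrt ?dot_CauchySchwarz// mulr_ge0 ?dot_ge0.
Qed.

Lemma enorm_ge0 x : 0 <= enorm x. Proof. exact: sqrtr_ge0. Qed.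

Lemma sqr_enorm x : enorm x ^+ 2 = dot x x.
Proof. by rewrite sqr_sqrtr ?dot_ge0. Qed.

Lemma enormN x : enorm (- x) = enorm x.
Proof. by rewrite /enorm dotNl dotNr opprK. Qed.

Lemma enormB_le x y : enorm x <= enorm y + enorm (x - y).
Proof.
rewrite -(ler_pXn2r (_ : 0 < 2)%N) ?nnegrE ?addr_ge0 ?enorm_ge0//.
rewrite sqrrD !sqr_enorm.
have -> : dot x x = dot y y + 2 * dot (x - y) y + dot (x - y) (x - y).
  by rewrite !dotBl !(dotC _ (x - _)) !dotBl (dotC y x); ring.
rewrite lerD2r lerD2l mulr_natl lerMn2r /= mulrC.
exact: le_trans (ler_norm _) (normr_dot_le _ _).
Qed.

Section sqrtmx.
Variable A : 'M[R]_n.+1.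
Hypothesis Asym : sym_nonneg A.

Lemma sqrtmxP : sym_nonneg (sqrtmx A) /\ sqrtmx A *m sqrtmx A = A.
Proof.
have [B AB] := sym_nonneg_sqrt Asym.
exact: (@xgetI _ 0 [set B | sym_nonneg B /\ B *m B = A] B AB).
Qed.

Lemma dot_sqrtmx x y :
  dot (mxact (sqrtmx A) x) (mxact (sqrtmx A) y) = dot x (mxact A y).
Proof.
have [[sB _] BB] := sqrtmxP.
by rewrite /mxact !dot_mulmxr !trmxK sB -mulmxA BB.
Qed.

End sqrtmx.

Lemma mxactB A x y : mxact A (x - y) = mxact A x - mxact A y.
Proof. exact: mulmxBl. Qed.

Lemma mxactN A x : mxact A (- x) = - mxact A x.
Proof. exact: mulNmx. Qed.

Lemma mxact0 A : mxact A 0 = 0.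
Proof. exact: mul0mx. Qed.

End matrix_square_root.

(** * Pointwise inequalities *)

Section pointwise_inequalities.
Context (R : realType).
Implicit Types (a b s z p r : R).

Lemma ler_wpowR r a b : 0 <= r -> 0 <= a -> a <= b -> a `^ r <= b `^ r.
Proof.
move=> r0 a0 ab; apply: ge0_ler_powR => //; rewrite nnegrE //.
exact: le_trans ab.
Qed.

Lemma ler_powRi r a b : 0 < r -> 0 <= a -> 0 <= b -> a `^ r <= b `^ r -> a <= b.
Proof.
move=> r0 a0 b0; rewrite !leNgt; apply: contra => ba.
by apply: gt0_ltr_powR => //; rewrite nnegrE.
Qed.

Lemma powRK r a : r != 0 -> 0 <= a -> (a `^ r) `^ r^-1 = a.
Proof. by move=> r0 a0; rewrite -powRrM divff// powRr1. Qed.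

Lemma powRVK r a : r != 0 -> 0 <= a -> (a `^ r^-1) `^ r = a.
Proof. by move=> r0 a0; rewrite -powRrM mulVf// powRr1. Qed.

Lemma powRD_le p a b : 0 <= p -> 0 <= a -> 0 <= b ->
  (a + b) `^ p <= 2 `^ p * (a `^ p + b `^ p).
Proof.
move=> p0 a0 b0; wlog ab : a b a0 b0 / a <= b => [h|].
  have [ab|/ltW ba] := leP a b; first exact: h.
  by rewrite addrC [X in _ * X]addrC; exact: h.
apply: (@le_trans _ _ ((2 * b) `^ p)).
  by rewrite ler_wpowR ?addr_ge0// mulr_natl mulr2n lerD2r.
rewrite powRM// ler_wpM2l ?powR_ge0//.
by rewrite lerDr powR_ge0.
Qed.

Lemma powR_subr1M p a : 0 < p -> 0 <= a -> a `^ (p - 1) * a = a `^ p.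
Proof. by move=> p0 a0; rewrite mulrC mulr_powRB1. Qed.

Lemma powR_subr2M p a : 1 < p -> 0 <= a -> a `^ (p - 2) * a = a `^ (p - 1).
Proof.
move=> p1 a0; have -> : p - 2 = p - 1 - 1 by ring.
by rewrite powR_subr1M// subr_gt0.
Qed.

(** Replacing the smaller of [a], [b] by the larger one produces one of the two terms on the
    right. *)
Lemma crude_Young p a b : 1 <= p -> 0 <= a -> 0 <= b ->
  a `^ (p - 1) * b <= a `^ p + b `^ p.
Proof.
move=> p1 a0 b0; have p0 : 0 < p by exact: lt_le_trans p1.
have [ab|/ltW ba] := leP a b.
  apply: (@le_trans _ _ (b `^ (p - 1) * b)).
    by rewrite ler_wpM2r// ler_wpowR// subr_ge0.
  by rewrite powR_subr1M// lerDr powR_ge0.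
apply: (@le_trans _ _ (a `^ (p - 1) * a)); first by rewrite ler_wpM2l ?powR_ge0.
by rewrite powR_subr1M// lerDl powR_ge0.
Qed.

(** With [b = a / (2 r)], the bound [ln b <= b] gives [b^r <= exp (r b) = exp (a / 2)]. *)
Lemma powR_le_expR r a : 0 < r -> 0 <= a -> a `^ r <= (2 * r) `^ r * expR (a / 2).
Proof.
move=> r0; rewrite le_eqVlt => /predU1P[<-|a0].
  by rewrite powR0 ?gt_eqF// mulr_ge0 ?powR_ge0 ?expR_ge0.
have r20 : 0 < 2 * r by rewrite mulr_gt0.
set b := a / (2 * r); have b0 : 0 < b by rewrite divr_gt0.
have -> : a = 2 * r * b by rewrite mulrC mulfVK// gt_eqF.
rewrite (powRM _ (ltW r20) (ltW b0)) ler_wpM2l ?powR_ge0//.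
rewrite {1}/powR gt_eqF// ler_expR.
apply: (@le_trans _ _ (r * b)); first by rewrite ler_pM2l// ltW// ln_sublinear.
by lra.
Qed.

(** Split at [s = exp z]: below it the first term suffices, above it the logarithm in [log_bump] is
    at least [z]. *)
Lemma powR_log_bump p sigma s z : 0 < p -> 0 <= sigma -> 0 <= s -> 1 <= z ->
  s `^ p <= expR (p * z) + z `^ (- sigma) * log_bump p sigma s.
Proof.
move=> p0 sigma0 s0 z1; have z0 : 0 < z by exact: lt_le_trans z1.
have N0 : 0 <= log_bump p sigma s by rewrite mulr_ge0 ?powR_ge0.
have [sz|/ltW zs] := leP s (expR z).
  rewrite mulrC expRM (le_trans (ler_wpowR _ s0 sz)) ?(ltW p0)//.
  by rewrite lerDl mulr_ge0 ?powR_ge0.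
rewrite (@le_trans _ _ (z `^ (- sigma) * log_bump p sigma s))//; last first.
  by rewrite lerDr expR_ge0.
rewrite powRN ler_pdivlMl ?powR_gt0// mulrC ler_wpM2l ?powR_ge0//.
rewrite ler_wpowR// ?(ltW z0)// -[leLHS]expRK ler_ln ?posrE ?expR_gt0//.
  by rewrite (le_trans zs)// lerDr expR_ge0.
by rewrite addr_gt0 ?expR_gt0// (lt_le_trans _ zs)// expR_gt0.
Qed.

(** Put [a = s^alpha] and [r = p / alpha], so that [s^p = a^r], and split at [a = 4 p z]. Below,
    [a^r] is of order [z^r]. Above, [a^r] is at most a multiple of [exp (a / 2)], and
    [a / 2 >= 2 p z] turns this into [exp (- 2 p z) exp a]; since [a >= 4] there,
    [exp a <= 2 (exp a - 1)]. *)
Lemma powR_exp_bump p alpha : 1 < p -> 0 < alpha ->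
  exists2 C : R, 0 < C & forall s z, 0 <= s -> 1 <= z ->
    s `^ p <= C * (z `^ (p / alpha) + expR (- (2 * p * z)) * exp_bump alpha s).
Proof.
move=> p1 alpha0; have p0 : 0 < p by exact: lt_trans p1.
set r := p / alpha; have r0 : 0 < r by rewrite divr_gt0.
pose C1 := (2 * r) `^ r * 2; pose C2 := (4 * p) `^ r.
have C10 : 0 < C1 by rewrite mulr_gt0// powR_gt0// mulr_gt0.
have C20 : 0 < C2 by rewrite powR_gt0// mulr_gt0.
exists (C1 + C2); first exact: addr_gt0.
move=> s z s0 z1; have z0 : 0 < z by exact: lt_le_trans z1.
set a := s `^ alpha; have a0 : 0 <= a by exact: powR_ge0.
have -> : s `^ p = a `^ r by rewrite -powRrM /r mulrC mulfVK ?gt_eqF.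
have B0 : 0 <= exp_bump alpha s by rewrite subr_ge0 leNgt expR_lt1 -leNgt.
have [az|za] := leP a (4 * p * z).
  rewrite (le_trans (ler_wpowR (ltW r0) a0 az))//.
  rewrite (powRM _ (_ : 0 <= 4 * p) (ltW z0)) ?mulr_ge0 ?(ltW p0)// mulrDr -/C2.
  rewrite (@le_trans _ _ ((C1 + C2) * z `^ r))//; last first.
    by rewrite lerDl !mulr_ge0 ?expR_ge0// addr_ge0 ?(ltW C10) ?(ltW C20).
  by rewrite ler_wpM2r ?powR_ge0// lerDr ltW.
rewrite (le_trans (powR_le_expR r0 a0))//.
apply: (@le_trans _ _ (C1 * (expR (- (2 * p * z)) * exp_bump alpha s))); last first.
  rewrite ler_pM ?(ltW C10) ?mulr_ge0 ?expR_ge0 ?lerDl ?(ltW C20)//.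
  by rewrite lerDr powR_ge0.
rewrite /C1 -mulrA ler_wpM2l ?powR_ge0//.
apply: (@le_trans _ _ (expR (- (2 * p * z)) * expR a)).
  by rewrite -expRD ler_expR; lra.
rewrite mulrCA ler_wpM2l ?expR_ge0// /exp_bump -/a.
have a4 : 4 <= a.
  have pz : 1 <= p * z by rewrite -[leLHS]mulr1 ler_pM ?(ltW p1).
  by apply: le_trans (ltW za); lra.
by have := expR_ge1Dx a; lra.
Qed.

Lemma powR_le_absorb p c kappa e : 1 < p -> 0 < c -> 0 < kappa -> 0 < e ->
  e `^ p <= c * kappa `^ (p - 1) * e -> e <= c `^ (p - 1)^-1 * kappa.
Proof.
move=> p1 c0 k0 e0; have q0 : 0 < p - 1 by rewrite subr_gt0.
rewrite -powR_subr1M ?(ltW e0) ?(lt_trans _ p1)// ler_pM2r// => le_ek.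
apply: (@ler_powRi (p - 1)) => //; rewrite ?mulr_ge0 ?powR_ge0 ?(ltW e0) ?(ltW k0)//.
by rewrite powRM ?powR_ge0 ?(ltW k0)// powRVK ?gt_eqF ?(ltW c0).
Qed.

(** A lower bound of mean value type. With [y = z + 1], the ratio [z^(-eps) / y^(-eps)] is the
    exponential of [eps (ln y - ln z) >= eps / y], and [y <= 2 z] since [z >= 1]. *)
Lemma powRN_decrement eps z : 0 < eps -> 1 <= z ->
  eps * 2 `^ (- (eps + 1)) * z `^ (- (eps + 1)) <= z `^ (- eps) - (z + 1) `^ (- eps).
Proof.
move=> e0 z1; have z0 : 0 < z by exact: lt_le_trans z1.
have y0 : 0 < z + 1 by rewrite addr_gt0.
set y := z + 1 in y0 *.
have lnzy : ln y - ln z >= y^-1.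
  rewrite -ln_div ?posrE// -lerN2 -lnV ?posrE ?divr_gt0// invf_div.
  have -> : z / y = 1 + - y^-1 by rewrite /y; field; rewrite gt_eqF.
  by apply: le_ln1Dx; rewrite ltrN2 invf_lt1// /y ltrDr.
have -> : z `^ (- eps) = y `^ (- eps) * expR (eps * (ln y - ln z)).
  by rewrite /powR !gt_eqF// -expRD; congr expR; ring.
rewrite -[X in _ <= _ - X]mulr1 -mulrBr.
apply: (@le_trans _ _ (y `^ (- eps) * (eps * y^-1))); last first.
  rewrite ler_wpM2l ?powR_ge0//.
  rewrite (@le_trans _ _ (eps * (ln y - ln z)))//; first by rewrite ler_pM2l.
  by have := expR_ge1Dx (eps * (ln y - ln z)); lra.
rewrite -(powR_inv1 (ltW y0)) mulrCA -mulrA ler_pM2l// -powRD; last first.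
  by rewrite (gt_eqF y0) implybT.
rewrite -powRM ?(ltW z0)// -opprD !powRN lef_pV2 ?posrE ?powR_gt0 ?mulr_gt0//.
by rewrite ler_wpowR// ?addr_ge0 ?(ltW e0) ?(ltW y0)// /y; lra.
Qed.

(** * Coercivity of the energy density up to the approximation error *)

Section energy_density.
Context (n : nat).
Implicit Types x y : 'rV[R]_n.+1.

(** Meant for [x = sqrt Q grad psi] and [y = sqrt Q G]. With [b = |y|], [d = |x - y|] and [e] the
    energy density, [b^p - e] is [b^(p-2)] times the product of [y - x] and [y], hence at most
    [b^(p-1) d]. If [d <= b / 2] this is at most half of [b^p], otherwise at most a multiple of
    [d^p]; either way [b^p <= 2 e + 2^p d^p], and [|x| <= b + d]. *)
Lemma enorm_powR_energy p x y : 1 < p ->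
  enorm x `^ p <= 2 * 2 `^ p * (enorm y `^ (p - 2) * dot x y)
                  + 2 `^ p * (2 `^ p + 1) * enorm (x - y) `^ p.
Proof.
move=> p1; have p0 : 0 < p by exact: lt_trans p1.
set b := enorm y; set d := enorm (x - y); set e := b `^ (p - 2) * dot x y.
have [b0 d0] : 0 <= b /\ 0 <= d by split; exact: enorm_ge0.
have bp : b `^ p = b `^ (p - 2) * dot y y.
  by rewrite -sqr_enorm expr2 mulrA powR_subr2M// powR_subr1M.
have : b `^ p - e <= b `^ p / 2 + 2 `^ p / 2 * d `^ p.
  apply: (@le_trans _ _ (b `^ (p - 1) * d)).
    rewrite bp -mulrBr -dotBl -(powR_subr2M p1 b0) -mulrA ler_wpM2l ?powR_ge0//.
    rewrite (le_trans (ler_norm _))// (le_trans (normr_dot_le _ _))//.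
    by rewrite mulrC -opprB enormN.
  have [db|/ltW bd] := leP d (b / 2).
    apply: (@le_trans _ _ (b `^ (p - 1) * (b / 2))).
      by rewrite ler_wpM2l ?powR_ge0.
    by rewrite mulrA powR_subr1M// lerDl mulr_ge0 ?divr_ge0 ?powR_ge0.
  apply: (@le_trans _ _ ((2 * d) `^ (p - 1) * d)).
    by rewrite ler_wpM2r// ler_wpowR ?subr_ge0 ?(ltW p1)//; lra.
  rewrite powRM// -mulrA powR_subr1M//.
  rewrite -(powR_subr1M p0 (_ : 0 <= 2))// mulfK//.
  by rewrite lerDr divr_ge0 ?powR_ge0.
have : enorm x `^ p <= 2 `^ p * (b `^ p + d `^ p).
  by rewrite (le_trans _ (powRD_le (ltW p0) b0 d0))// ler_wpowR ?enorm_ge0 ?(ltW p0)// enormB_le.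
have := powR_ge0 2 p; set c := 2 `^ p; set B := b `^ p; set D := d `^ p.
move=> c0 h1 h2; apply: (le_trans h1).
have h3 : B <= 2 * e + c * D by lra.
by have := ler_wpM2l c0 h3; lra.
Qed.

Lemma normr_energy_le p x y : 1 < p ->
  `|enorm y `^ (p - 2) * dot x y| <= enorm y `^ p + enorm x `^ p.
Proof.
move=> p1; rewrite normrM ger0_norm ?powR_ge0//.
rewrite (@le_trans _ _ (enorm y `^ (p - 1) * enorm x))//.
  rewrite -(powR_subr2M p1 (enorm_ge0 y)) -mulrA ler_wpM2l ?powR_ge0//.
  by rewrite mulrC normr_dot_le.
by rewrite crude_Young ?enorm_ge0// ltW.
Qed.

End energy_density.

End pointwise_inequalities.

(** * Lebesgue measurability *)

Section lebesgue_measurability.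
Context (R : realType) (n : nat).
Local Notation V := 'rV[R]_n.+1.
Implicit Types (x y a b : V) (c : R).

(** Cutting an interval at [c] preserves total length, also for empty intervals and for [c] outside;
    this makes the truncated box volume additive. *)
Lemma max_interval_split (l r c : R) :
  Num.max 0 (r - Num.max l c) + Num.max 0 (Num.min r c - l) = Num.max 0 (r - l).
Proof.
case: (leP l c) => lc; case: (leP r c) => rc;
by repeat match goal with
  |- context [Order.max 0 ?t] => case: (leP 0 t) => ? end; lra.
Qed.

Definition set_coord a (i : 'I_n.+1) c : V := \row_j (if j == i then c else a 0 j).

Lemma set_coordE a i c : set_coord a i c 0 i = c.
Proof. by rewrite mxE eqxx. Qed.

Lemma box_volume_split a b (i : 'I_n.+1) c :
  (box_volume (set_coord a i (Num.max (a 0 i) c)%R) b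
     + box_volume a (set_coord b i (Num.min (b 0 i) c)%R) = box_volume a b)%E.
Proof.
rewrite /box_volume -EFinD; congr EFin.
rewrite (bigD1 i)//= [X in _ + X](bigD1 i)//= [RHS](bigD1 i)//= !set_coordE.
rewrite -[in RHS](max_interval_split _ _ c) mulrDl; congr (_ * _ + _ * _).
  by apply: eq_bigr => j /negbTE ji; rewrite mxE ji.
by apply: eq_bigr => j /negbTE ji; rewrite mxE ji.
Qed.

(** Caratheodory's criterion: each box of a cover is cut along the hyperplane [x 0 i = c], and the
    two families of pieces cover the two parts of [X] with the same total volume. *)
Lemma halfspace_measurable (i : 'I_n.+1) c : measurable [set x : V | c < x 0 i].
Proof.
apply: le_caratheodory_measurable => X.
apply: le_ereal_inf_tmp => _ [C XC <-].
pose C1 k := (set_coord (C k).1 i (Num.max ((C k).1 0 i) c), (C k).2).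
pose C2 k := ((C k).1, set_coord (C k).2 i (Num.min ((C k).2 0 i) c)).
apply: (@le_trans _ _ (\sum_(k <oo) box_volume (C1 k).1 (C1 k).2
                      + \sum_(k <oo) box_volume (C2 k).1 (C2 k).2)%E); last first.
  rewrite -nneseriesD; try by move=> *; exact: box_volume_ge0.
  by apply: lee_nneseries => [k *|k _]; rewrite ?adde_ge0 ?box_volume_ge0// box_volume_split.
apply: leeD; apply: ereal_inf_lbound.
  exists C1 => // x [/XC[k _ xk] /= cx]; exists k => // j /=.
  by have := xk j; rewrite mxE; case: eqP => [->|//]; rewrite gt_max cx andbT.
exists C2 => // x [/XC[k _ xk] /= /negP cx]; exists k => // j /=.
have := xk j; rewrite mxE; case: eqP => [->|//] /andP[-> xb].
by rewrite le_min xb leNgt cx.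
Qed.

Lemma coord_measurable (i : 'I_n.+1) : measurable_fun setT (fun x : V => x 0 i).
Proof.
apply: (measurability _ (RGenOInfty.measurableE R)).
move=> _ [_ [c ->] <-]; rewrite setTI preimage_itvoy.
exact: halfspace_measurable.
Qed.

(** [U] is the union of the countably many open boxes with rational corners that it contains; balls
    of the sup norm are themselves boxes. *)
Lemma rV_open_measurable (U : set V) : open U -> measurable U.
Proof.
move=> oU; pose Q := ('rV[rat]_n.+1 * 'rV[rat]_n.+1)%type.
pose obox (q : Q) : set V :=
  \bigcap_(i in [set: 'I_n.+1])
    [set x | ratr (q.1 0 i) < x 0 i /\ x 0 i < ratr (q.2 0 i)].
have mobox q : measurable (obox q).
  apply: fin_bigcap_measurable => // i _.
  rewrite [X in measurable X](_ : _ =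
      setT `&` (fun x : V => x 0 i) @^-1` `]ratr (q.1 0 i), ratr (q.2 0 i)[).
    by apply: coord_measurable => //; exact: measurable_itv.
  by rewrite setTI; apply/seteqP; split => x /=; rewrite in_itv /= => /andP.
suff -> : U = \bigcup_(q : Q) (if `[< obox q `<=` U >] then obox q else set0).
  by apply: countable_bigcupT_measurable => [|q]; [exact: countableP|case: asboolP].
apply/seteqP; split => [x Ux|x [q _]]; last by case: asboolP => // qU qx; exact: qU.
have /nbhs_ballP[e /= e0 xeU] := open_nbhs_nbhs (conj oU Ux).
have /choice[q1 q1P] : forall i, exists q : rat, ratr q \in `]x 0 i - e, x 0 i[.
  by move=> i; apply: rat_in_itvoo; rewrite ltrBlDr ltrDl.
have /choice[q2 q2P] : forall i, exists q : rat, ratr q \in `]x 0 i, x 0 i + e[.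
  by move=> i; apply: rat_in_itvoo; rewrite ltrDl.
exists (\row_i q1 i, \row_i q2 i) => //; case: asboolP => [_ i _|[]] /=.
  by have := q1P i; have := q2P i; rewrite !mxE !in_itv /= => /andP[-> _] /andP[_ ->].
move=> y qy; apply: xeU; split => // i j; rewrite ord1 {i}.
have [] := qy j I; have := q1P j; have := q2P j; rewrite !mxE !in_itv /=.
move=> /andP[? ?] /andP[? ?] ? ?.
by rewrite /ball /= ltr_distlC; apply/andP; split; lra.
Qed.

Lemma rV_closed_measurable (F : set V) : closed F -> measurable F.
Proof. by move/closed_openC/rV_open_measurable/measurableC; rewrite setCK. Qed.

Lemma rV_continuous_measurable (f : V -> R) : continuous f -> measurable_fun setT f.
Proof.
move=> cf; apply: (measurability _ (RGenOInfty.measurableE R)).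
move=> _ [_ [c ->] <-]; rewrite setTI; apply: rV_open_measurable.
by move/continuousP: cf; apply; exact: interval_open.
Qed.

(** For fixed [h] the difference quotient [d h] is continuous, so a bound required for all small [h]
    defines an intersection of closed sets, which is closed although the family is uncountable. Only
    countable operations are then needed to describe convergence and the size of the limit. *)
Lemma derive_measurable (f : V -> R) (e : V) :
  continuous f -> measurable_fun setT (fun x => 'D_e f x).
Proof.
move=> cf; pose d (h : R) x := h^-1 *: ((f \o shift x) (h *: e) - f x) : R.
have cd h : continuous (d h).
  move=> x; apply: (@continuousZl_tmp _ _ _ (fun x => f (h *: e + x) - f x)).
  apply: (@continuousB _ _ _ (fun x => f (h *: e + x)) f); last exact: cf.
  apply: (@continuous_comp _ _ _ (fun x => h *: e + x) f); last exact: cf.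
  by apply: (@continuousD _ _ _ (cst (h *: e)) id); [exact: cst_continuous|move=> ?].
pose near0 (m : nat) (h : R) := h != 0 /\ `|h| < m.+1%:R^-1.
pose U c m := \bigcap_(h in near0 m) [set x | d h x <= c].
pose L c m := \bigcap_(h in near0 m) [set x | c <= d h x].
have mU c m : measurable (U c m).
  apply: rV_closed_measurable; apply: closed_bigI => h _.
  by apply: (@closed_comp _ _ (d h) [set y | y <= c]) => [x _|]; [exact: cd|exact: closed_le].
have mL c m : measurable (L c m).
  apply: rV_closed_measurable; apply: closed_bigI => h _.
  by apply: (@closed_comp _ _ (d h) [set y | c <= y]) => [x _|]; [exact: cd|exact: closed_ge].
(* The Cauchy condition: for each [k] the quotients eventually stay within [1 / (k + 1)] of some
   rational. [E] is the set where the derivative exists. *)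
pose E := \bigcap_(k : nat) \bigcup_(q : rat) \bigcup_(m : nat)
  (U (ratr q + k.+1%:R^-1) m `&` L (ratr q - k.+1%:R^-1) m).
have mE : measurable E.
  apply: bigcapT_measurable => k; apply: bigcupT_measurable_rat => q.
  by apply: bigcupT_measurable => m; exact: measurableI.
have nearP (P : R -> Prop) : (\forall h \near 0^', P h) <->
    exists m, forall h, near0 m h -> P h.
  split => [/nbhs_ballP[r /= r0 rP]|[m mP]].
    have [m mr] := ltr_add_invr r0; rewrite add0r in mr.
    exists m => h [h0 hm]; apply: rP => //.
    by rewrite /ball /= sub0r normrN (lt_trans hm).
  apply/nbhs_ballP; exists m.+1%:R^-1 => /=; first by rewrite invr_gt0.
  by move=> h; rewrite /ball /= sub0r normrN => hm h0; apply: mP; split.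
have EP x : E x <-> cvg (d h x @[h --> 0^']).
  split=> [Ex|/cvg_ex[l dl] k _].
    apply: cauchy_cvg; apply: cauchy_exP => r r0.
    have [k kr] := ltr_add_invr r0; rewrite add0r in kr.
    have [q _ [m _ [Um Lm]]] := Ex k I; exists (ratr q).
    apply/nearP; exists m => h hm; have := Um h hm; have := Lm h hm.
    rewrite /= /ball /= distrC ltr_distlC.
    move: (d h x) (ratr q : R) (k.+1%:R^-1 : R) kr => y w z kr A1 A2.
    by apply/andP; split; lra.
  have : 0 < k.+1%:R^-1 :> R by rewrite invr_gt0.
  move: (k.+1%:R^-1 : R) => w w0; have w20 : 0 < w / 2 by rewrite divr_gt0.
  have [q] : exists q, ratr q \in `]l - w / 2, l + w / 2[.
    by apply: rat_in_itvoo; lra.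
  rewrite in_itv /= => /andP[q1 q2]; exists q => //.
  move/cvgrPdist_lt : dl => /(_ _ w20) /nearP[m mP]; exists m => //.
  by split=> h /mP; rewrite ltr_distlC => /andP[? ?] /=; lra.
pose Dle c := \bigcap_(k : nat) \bigcup_(m : nat) U (c + k.+1%:R^-1) m.
have mDle c : measurable (Dle c).
  by apply: bigcapT_measurable => k; apply: bigcupT_measurable.
have DleP x c : E x -> Dle c x <-> 'D_e f x <= c.
  move=> /EP cvgd; have dl : d h x @[h --> 0^'] --> 'D_e f x by [].
  split=> [Dx|Dc k _].
    apply/ler_addgt0Pr => r r0.
    have [k kr] := ltr_add_invr r0; rewrite add0r in kr.
    have [m _ Um] := Dx k I.
    rewrite (@le_trans _ _ (c + k.+1%:R^-1))//; last by rewrite lerD2l ltW.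
    by apply: (limr_le cvgd); apply/nearP; exists m => h /Um.
  have : 0 < k.+1%:R^-1 :> R by rewrite invr_gt0.
  move: (k.+1%:R^-1 : R) => w k0.
  move/cvgrPdist_lt : dl => /(_ _ k0) /nearP[m mP]; exists m => // h /mP /=.
  by rewrite ltr_distlC => /andP[? ?]; lra.
have D0 x : ~ E x -> 'D_e f x = 0.
  by move=> /EP; exact: dvgP.
apply: (measurability _ (RGenOInfty.measurableE R)).
move=> _ [_ [c ->] <-]; rewrite setTI preimage_itvoy.
(* Off [E] the derivative has the default value [0], which exceeds [c] exactly when [c < 0]. *)
have -> : [set x | c < 'D_e f x] =
    (E `&` ~` Dle c) `|` (if c < 0 then ~` E else set0).
  apply/seteqP; split => x /= => [cD|[[Ex nDle]|]].
  - have [Ex|nEx] := pselect (E x); first by left; split => // /(DleP x c Ex); rewrite leNgt cD.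
    by right; rewrite D0// in cD; rewrite cD.
  - by rewrite ltNge; apply/negP => /(DleP x c Ex).
  - by case: ifPn => // c0 /D0 ->.
apply: measurableU; last by case: ifP => _ //; exact: measurableC.
by apply: measurableI => //; exact: measurableC.
Qed.

End lebesgue_measurability.

(** * Truncations of Lipschitz functions *)

Section truncation.
Context (R : realType) (n : nat).
Local Notation V := 'rV[R]_n.+1.
Implicit Types (Omega : set V) (psi phi : V -> R) (x : V) (k : R).

Definition trunc k psi : V -> R := fun x => Num.max 0 (psi x - k).

Lemma trunc_ge0 k psi x : 0 <= trunc k psi x.
Proof. by rewrite le_max lexx. Qed.

Lemma trunc_eq0 k psi x : (trunc k psi x == 0) = (psi x <= k).
Proof. by rewrite /trunc -subr_le0; case: ltP; rewrite ?eqxx// => /gt_eqF ->. Qed.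

Lemma trunc_gtE k psi x : k < psi x -> trunc k psi x = psi x - k.
Proof. by move=> h; rewrite /trunc max_r// subr_ge0 ltW. Qed.

Lemma trunc_dist_le k psi x y : `|trunc k psi x - trunc k psi y| <= `|psi x - psi y|.
Proof.
have := ler_norm (psi x - psi y); have := ler_norm (- (psi x - psi y)).
rewrite normrN /trunc ler_norml => ? ?.
by case: (ltP 0 (psi x - k)); case: (ltP 0 (psi y - k)) => ? ?;
  apply/andP; split; lra.
Qed.

Lemma locally_lipschitz_dist_le Omega psi phi :
  (forall x y, `|phi x - phi y| <= `|psi x - psi y|) ->
  locally_lipschitz Omega psi -> locally_lipschitz Omega phi.
Proof.
move=> phi_le lpsi x Ox; have [c [U Ux lU]] := lpsi x Ox.
exists c, U => // -[y z] yz; apply: le_trans (lU (y, z) yz).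
exact: phi_le.
Qed.

Lemma Lip0_sub Omega psi phi :
  (forall x y, `|phi x - phi y| <= `|psi x - psi y|) ->
  (forall x, psi x = 0 -> phi x = 0) -> Lip0 Omega psi -> Lip0 Omega phi.
Proof.
move=> phi_le phi0 [lpsi cpsi spsi].
have sub : closure [set x | phi x != 0] `<=` closure [set x | psi x != 0].
  apply: closure_subset => x /= /eqP phix; apply/eqP => psix.
  exact/phix/phi0.
split; first exact: locally_lipschitz_dist_le lpsi.
  apply: subclosed_compact sub => //; exact: closed_closure.
exact: subset_trans sub spsi.
Qed.

Lemma Lip0_trunc Omega k psi : 0 <= k -> Lip0 Omega psi -> Lip0 Omega (trunc k psi).
Proof.
move=> k0; apply: Lip0_sub; first exact: trunc_dist_le.
by move=> x psi0; apply/eqP; rewrite trunc_eq0 psi0.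
Qed.

Lemma Lip0N Omega psi : Lip0 Omega psi -> Lip0 Omega (fun x => - psi x).
Proof.
apply: Lip0_sub => [x y|x ->]; last by rewrite oppr0.
by rewrite opprK addrC distrC.
Qed.

(** Off [Omega], the function vanishes on a whole neighbourhood, because the complement of its
    closed support is open. *)
Lemma Lip0_continuous Omega psi : Lip0 Omega psi -> continuous psi.
Proof.
move=> [lpsi _ spsi] x; have [Ox|nOx] := pselect (Omega x); last first.
  have nx : nbhs x (~` closure [set x | psi x != 0]).
    apply: open_nbhs_nbhs; split; last by move=> /spsi.
    by apply: closed_openC; exact: closed_closure.
  have psi0 y : ~ closure [set x | psi x != 0] y -> psi y = 0.
    by move=> ny; apply/eqP/negPn/negP => py; apply: ny; exact: subset_closure.
  apply: (near_cst_continuous (psi x)).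
  by apply: filterS (nx) => y ny; rewrite (psi0 y ny) (psi0 x (nbhs_singleton nx)).
have [c [U Ux lU]] := lpsi x Ox.
suff : psi y @[y --> x] --> psi x by [].
apply/(@cvgrPdist_lt _ _ _ (nbhs x) (nbhs_filter x)) => e e0; near=> y.
have Uxy : (U `*` U) (x, y) by split => /=; [exact: nbhs_singleton|near: y].
apply: le_lt_trans (lU _ Uxy) _ => /=.
have c1 : 0 < `|c| + 1 by rewrite ltr_pwDr.
apply: (@le_lt_trans _ _ ((`|c| + 1) * `|x - y|)).
  by rewrite ler_wpM2r// (le_trans (ler_norm _))// lerDl.
rewrite -ltr_pdivlMl// mulrC; near: y.
by apply: cvgr_dist_lt; rewrite ?divr_gt0//; exact: cvg_id.
Unshelve. all: by end_near. Qed.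

(* Where the derivative does not exist, ['D] takes the value [0]. *)
Lemma derive_min_eq0 phi x (e : V) :
  (forall y, 0 <= phi y) -> phi x = 0 -> 'D_e phi x = 0.
Proof.
move=> phi0 phix; have [dphi|/dvgP//] := pselect (derivable phi x e).
apply/eqP/negPn/negP => D0; have D1 : 0 < `|'D_e phi x| by rewrite normr_gt0.
have /nbhs_ballP[r /= r0 rP] : \forall h \near 0^',
    `|'D_e phi x - h^-1 * phi (h *: e + x)| < `|'D_e phi x|.
  have dl : h^-1 *: ((phi \o shift x) (h *: e) - phi x) @[h --> 0^']
    --> 'D_e phi x by exact: dphi.
  move/cvgrPdist_lt : dl => /(_ _ D1); apply: filterS => h.
  by rewrite phix subr0.
have rh (h : R) : `|h| = r / 2 -> `|'D_e phi x - h^-1 * phi (h *: e + x)| < `|'D_e phi x|.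
  move=> hr; apply: rP; first by rewrite /ball /= sub0r normrN hr ltr_pdivrMr// ltr_pMr// ltr1n.
  by rewrite -normr_gt0 hr divr_gt0.
have r2 : 0 < r / 2 by rewrite divr_gt0.
have := phi0 ((r / 2) *: e + x); have := phi0 (- (r / 2) *: e + x) => p1 p2.
have [Dn|Dp] := leP ('D_e phi x) 0.
  have := rh (r / 2); rewrite gtr0_norm// => /(_ erefl).
  have : 0 <= (r / 2)^-1 * phi ((r / 2) *: e + x) by rewrite mulr_ge0// invr_ge0 ltW.
  move: (_ * phi _) => w w0; rewrite (ler0_norm Dn) ltr_norml => /andP[? ?]; lra.
have := rh (- (r / 2)); rewrite normrN gtr0_norm// => /(_ erefl).
have : (- (r / 2))^-1 * phi (- (r / 2) *: e + x) <= 0.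
  by rewrite invrN mulNr oppr_le0 mulr_ge0// invr_ge0 ltW.
move: (_ * phi _) => w w0; rewrite (gtr0_norm Dp) ltr_norml => /andP[? ?]; lra.
Qed.

Lemma near_eq_fmap (T U : Type) (F : set_system T) (FF : Filter F) (f g : T -> U) :
  (\forall h \near F, f h = g h) -> f @ F = g @ F.
Proof.
move=> fg; apply/seteqP; split => P /=; rewrite /fmap /= => FP;
by apply: filterS2 fg FP => h /= ->.
Qed.

(** The difference quotients agree for small increments, so their limits agree, including the
    default value where there is none. *)
Lemma near_shift_derive phi psi c x (e : V) :
  (\forall y \near x, phi y = psi y + c) -> 'D_e phi x = 'D_e psi x.
Proof.
move=> h; rewrite /derive; congr (lim _); apply: near_eq_fmap.
have cs : (h *: e + x) @[h --> (0 : R)] --> x.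
  suff : (h *: e + x) @[h --> (0 : R)] --> 0 *: e + x by rewrite scale0r add0r.
  by apply: cvgD; [apply: cvgZr_tmp; exact: cvg_id|exact: cvg_cst].
have ch : \forall t \near (0 : R), phi (t *: e + x) = psi (t *: e + x) + c.
  exact: (cs _ h).
apply: nbhs_dnbhs; near=> t; rewrite /= (near ch t)//.
by rewrite (nbhs_singleton h) opprD addrACA subrr addr0.
Unshelve. all: by end_near. Qed.

Lemma gradN psi x : grad (fun y => - psi y) x = - grad psi x.
Proof.
apply/rowP => i; rewrite !mxE.
have [d|nd] := pselect (derivable psi x (delta_mx 0 i)); first exact: deriveN.
have -> : 'D_(delta_mx 0 i) psi x = 0 by exact: dvgP nd.
rewrite oppr0; apply: dvgP; apply: contra_not nd => /derivableN.
by rewrite (_ : - _ = psi)//; apply/funext => y /=; rewrite opprK.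
Qed.

(** Where [psi x > k], continuity makes the truncation equal to [psi - k] near [x]; elsewhere [x] is
    a minimum point of the truncation. *)
Lemma grad_trunc k psi x : {for x, continuous psi} ->
  grad (trunc k psi) x = if k < psi x then grad psi x else 0.
Proof.
move=> cpsi; apply/rowP => i; case: ltP => kx; rewrite !mxE; last first.
  apply: derive_min_eq0 => [y|]; first exact: trunc_ge0.
  by apply/eqP; rewrite trunc_eq0.
apply: (@near_shift_derive _ _ (- k)).
near=> y; rewrite trunc_gtE//; near: y.
exact: (cvgr_gt (psi x)).
Unshelve. all: by end_near. Qed.

End truncation.

(** * Integral bounds *)

Section integral_bounds.
Context d (T : measurableType d) (R : realType) (mu : {measure set T -> \bar R}).
Context (D : set T) (mD : measurable D).
Implicit Types (F H a b w e : T -> R).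

Lemma measurable_fun_powRl F (r : R) :
  measurable_fun D F -> measurable_fun D (fun x => F x `^ r).
Proof. by move=> mF; exact: (measurableT_comp (measurable_powR r) mF). Qed.

Lemma measurable_fun_norm F :
  measurable_fun D F -> measurable_fun D (fun x => `|F x|).
Proof. by move=> mF; exact: (measurableT_comp (@normr_measurable R setT) mF). Qed.

Lemma measurable_fun_bool_real (P : T -> bool) :
  measurable_fun D P -> measurable_fun D (fun x => (P x)%:R : R).
Proof.
move=> mP; rewrite (_ : (fun x => _) = (fun b : bool => b%:R : R) \o P)//.
by apply: measurableT_comp.
Qed.

Lemma integral_le_lincomb F F1 F2 (c1 c2 A1 A2 : R) :
  measurable_fun D F -> measurable_fun D F1 -> measurable_fun D F2 ->
  (forall x, D x -> 0 <= F x) -> (forall x, D x -> 0 <= F1 x) ->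
  (forall x, D x -> 0 <= F2 x) -> 0 <= c1 -> 0 <= c2 ->
  (forall x, D x -> F x <= c1 * F1 x + c2 * F2 x) ->
  (\int[mu]_(x in D) (F1 x)%:E <= A1%:E)%E ->
  (\int[mu]_(x in D) (F2 x)%:E <= A2%:E)%E ->
  (\int[mu]_(x in D) (F x)%:E <= (c1 * A1 + c2 * A2)%:E)%E.
Proof.
move=> mF mF1 mF2 F0 F10 F20 c10 c20 leF I1 I2.
apply: (@le_trans _ _ (\int[mu]_(x in D) (c1%:E * (F1 x)%:E + c2%:E * (F2 x)%:E))%E).
  apply: ge0_le_integral => //.
  - exact/measurable_EFinP.
  - by apply: emeasurable_funD; apply: measurable_funeM; exact/measurable_EFinP.
have pos c F' : 0 <= c -> (forall x, D x -> 0 <= F' x) ->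
    forall x, D x -> (0 <= c%:E * (F' x)%:E)%E.
  by move=> c0 F'0 x Dx; rewrite -EFinM lee_fin mulr_ge0// F'0.
have meas c F' : measurable_fun D F' -> measurable_fun D (fun x => c%:E * (F' x)%:E)%E.
  by move=> mF'; apply: measurable_funeM; exact/measurable_EFinP.
rewrite (ge0_integralD _ mD (pos _ _ c10 F10) (meas _ _ mF1)
  (pos _ _ c20 F20) (meas _ _ mF2)).
rewrite !ge0_integralZl_EFin//; try exact/measurable_EFinP.
by rewrite EFinD !EFinM leeD// lee_wpmul2l.
Qed.

Lemma integral_le_scale F F1 (c A : R) :
  measurable_fun D F -> measurable_fun D F1 ->
  (forall x, D x -> 0 <= F x) -> (forall x, D x -> 0 <= F1 x) -> 0 <= c ->
  (forall x, D x -> F x <= c * F1 x) ->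
  (\int[mu]_(x in D) (F1 x)%:E <= A%:E)%E ->
  (\int[mu]_(x in D) (F x)%:E <= (c * A)%:E)%E.
Proof.
move=> mF mF1 F0 F10 c0 leF I1; rewrite -[c * A]addr0 -(mul0r A).
apply: (@integral_le_lincomb _ F1 F1) => // x Dx.
by rewrite mul0r addr0 leF.
Qed.

Lemma integrable_dominated e F (A : R) :
  measurable_fun D e -> measurable_fun D F -> (forall x, D x -> `|e x| <= F x) ->
  (\int[mu]_(x in D) (F x)%:E <= A%:E)%E -> mu.-integrable D (EFin \o e).
Proof.
move=> me mF eF IF; apply/integrableP; split; first exact/measurable_EFinP.
apply: le_lt_trans (ltry A); apply: le_trans IF.
apply: ge0_le_integral => //.
- by apply: measurableT_comp => //; exact/measurable_EFinP.
- exact/measurable_EFinP.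
Qed.

(** For the energy density, which has no sign: linearity of the integral then rests on the
    integrability of [e]. *)
Lemma integral_le_signed F H e (c1 c2 A B : R) :
  measurable_fun D F -> measurable_fun D H ->
  (forall x, D x -> 0 <= F x) -> (forall x, D x -> 0 <= H x) ->
  0 <= c1 -> 0 <= c2 -> mu.-integrable D (EFin \o e) ->
  (forall x, D x -> F x <= c1 * e x + c2 * H x) ->
  (\int[mu]_(x in D) (e x)%:E <= A%:E)%E ->
  (\int[mu]_(x in D) (H x)%:E <= B%:E)%E ->
  (\int[mu]_(x in D) (F x)%:E <= (c1 * A + c2 * B)%:E)%E.
Proof.
move=> mF mH F0 H0 c10 c20 ie leF Ie IH.
have me : measurable_fun D e by apply/measurable_EFinP; exact: measurable_int ie.
have iH : mu.-integrable D (EFin \o H).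
  by apply: (@integrable_dominated _ H B) => // x Dx; rewrite ger0_norm ?H0.
apply: (@le_trans _ _ (\int[mu]_(x in D) (c1%:E * (e x)%:E + c2%:E * (H x)%:E))%E).
  apply: ge0_le_integral => //.
  - exact/measurable_EFinP.
  - by apply: emeasurable_funD; apply: measurable_funeM; exact/measurable_EFinP.
rewrite integralD//; [|exact: integrableZl ie|exact: integrableZl iH].
rewrite !integralZl//.
by rewrite EFinD !EFinM leeD// lee_wpmul2l.
Qed.

(** The pointwise inequality [crude_Young] is applied to [a / A] and [b / B]; each of its two terms
    contributes once, whence the factor 2. *)
Lemma integral_crude_Hoelder (p A B : R) a b w : 1 < p ->
  measurable_fun D a -> measurable_fun D b -> measurable_fun D w ->
  (forall x, D x -> 0 <= a x) -> (forall x, D x -> 0 <= b x) ->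
  (forall x, D x -> 0 <= w x) -> 0 < A -> 0 < B ->
  (\int[mu]_(x in D) (a x `^ p * w x)%:E <= (A `^ p)%:E)%E ->
  (\int[mu]_(x in D) (b x `^ p * w x)%:E <= (B `^ p)%:E)%E ->
  (\int[mu]_(x in D) (a x `^ (p - 1) * b x * w x)%:E
     <= (2 * (A `^ (p - 1) * B))%:E)%E.
Proof.
move=> p1 ma mb mw a0 b0 w0 A0 B0 Ia Ib.
have p0 : 0 < p by exact: lt_trans p1.
have mp F (r : R) : measurable_fun D F -> measurable_fun D (fun x => F x `^ r * w x).
  by move=> mF; apply: measurable_funM => //; exact: measurable_fun_powRl.
set K := A `^ (p - 1) * B; have K0 : 0 < K by rewrite mulr_gt0 ?powR_gt0.
have -> : 2 * K = K / A `^ p * A `^ p + K / B `^ p * B `^ p.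
  by rewrite !mulfVK ?gt_eqF ?powR_gt0// mulr2n mulrDl mul1r.
apply: integral_le_lincomb Ia Ib; rewrite ?divr_ge0 ?(ltW K0) ?powR_ge0//.
- apply: measurable_funM => //; apply: measurable_funM => //.
  exact: measurable_fun_powRl.
- exact: mp.
- exact: mp.
- by move=> x Dx; rewrite !mulr_ge0 ?powR_ge0 ?b0 ?w0.
- by move=> x Dx; rewrite mulr_ge0 ?powR_ge0 ?w0.
- by move=> x Dx; rewrite mulr_ge0 ?powR_ge0 ?w0.
move=> x Dx; rewrite !mulrA -mulrDl ler_wpM2r ?w0//.
have -> : a x = A * (a x / A) by rewrite mulrC mulfVK ?gt_eqF.
have -> : b x = B * (b x / B) by rewrite mulrC mulfVK ?gt_eqF.
have aA : 0 <= a x / A by rewrite divr_ge0 ?a0 ?ltW.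
have bB : 0 <= b x / B by rewrite divr_ge0 ?b0 ?ltW.
rewrite (powRM (p - 1) (ltW A0) aA) (powRM p (ltW A0) aA) (powRM p (ltW B0) bB).
have := crude_Young (ltW p1) aA bB.
move: (a x / A) (b x / B) aA bB => s t s0 t0 h.
have -> : K / A `^ p * (A `^ p * s `^ p) = K * s `^ p.
  by rewrite mulrA mulfVK ?gt_eqF ?powR_gt0.
have -> : K / B `^ p * (B `^ p * t `^ p) = K * t `^ p.
  by rewrite mulrA mulfVK ?gt_eqF ?powR_gt0.
rewrite -mulrDr [leLHS](_ : _ = K * (s `^ (p - 1) * t)); last by rewrite /K; ring.
by rewrite ler_pM2l.
Qed.

End integral_bounds.

Lemma le_poweRV (R : realType) (p E : R) (X : \bar R) : 0 < p -> (0 <= X)%E -> 0 <= E ->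
  ((X `^ p^-1 <= E%:E) = (X <= (E `^ p)%:E))%E.
Proof.
move=> p0 X0 E0; have pV : p^-1 != 0 by rewrite invr_neq0// gt_eqF.
case: X X0 => [r|_|//]; last by rewrite poweRyr.
rewrite lee_fin => r0; rewrite poweR_EFin !lee_fin; apply/idP/idP => h.
  rewrite -[leLHS](powRVK (_ : p != 0) r0) ?gt_eqF//.
  by rewrite ler_wpowR// ?powR_ge0// ltW.
rewrite -[leRHS](powRK (_ : p != 0) E0) ?gt_eqF//.
by rewrite ler_wpowR// invr_ge0 ltW.
Qed.

Lemma Orlicz_norm_lt (R : realType) n (Omega : set 'rV[R]_n.+1) v Phi h (lam : R) :
  (Orlicz_norm Omega v Phi h < lam%:E)%E -> exists l : R, [/\ 0 < l, l < lam &
    (\int[leb]_(x in Omega) (Phi (`|h x| / l) * v x)%:E <= 1)%E].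
Proof.
move=> /ereal_inf_lt[_ [l [l0 hl] <-]]; rewrite lte_fin => llam.
by exists l.
Qed.

(** * Bounds in the p-th power on sets of exponentially small measure *)

Section weighted_estimates.
Context d (T : measurableType d) (R : realType) (mu : {measure set T -> \bar R}).
Context (D : set T) (mD : measurable D) (w : T -> R).
Hypotheses (mw : measurable_fun D w) (w0 : forall x, D x -> 0 <= w x).
Implicit Types (h phi psi : T -> R).
Local Notation "'Int' F" := (\int[mu]_(x in D) (F x)%:E)%E (at level 10, F at level 9).

Lemma measurable_funMw h : measurable_fun D h -> measurable_fun D (fun x => h x * w x).
Proof. by move=> mh; exact: measurable_funM. Qed.

Lemma measurable_log_bump (p sigma : R) h : measurable_fun D h ->
  measurable_fun D (fun x => log_bump p sigma (h x)).
Proof.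
move=> mh; apply: measurable_funM; apply: measurable_fun_powRl => //.
apply: (measurableT_comp (@measurable_ln R)).
by apply: measurable_funD => //; exact: measurable_cst.
Qed.

Lemma measurable_exp_bump (a : R) h : measurable_fun D h ->
  measurable_fun D (fun x => exp_bump a (h x)).
Proof.
move=> mh; apply: measurable_funB; last exact: measurable_cst.
by apply: (measurableT_comp (@measurable_expR R)); exact: measurable_fun_powRl.
Qed.

Lemma measurable_divr h (l : R) : measurable_fun D h ->
  measurable_fun D (fun x => h x / l).
Proof. by move=> mh; apply: measurable_funM => //; exact: measurable_cst. Qed.

Lemma log_bump_ge0 (p sigma s : R) : 0 <= log_bump p sigma s.
Proof. by rewrite mulr_ge0 ?powR_ge0. Qed.

Lemma exp_bump_ge0 (a s : R) : 0 <= exp_bump a s.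
Proof. by rewrite subr_ge0 leNgt expR_lt1 -leNgt powR_ge0. Qed.

(* A function supported on a set of measure of order [exp (-2 p z)] gains the
   factor [z^(-sigma)] over the trivial embedding of [L^N] into [L^p]. *)
Lemma integral_powR_log_bump (p sigma m : R) : 1 < p -> 0 < sigma -> 0 < m ->
  exists2 C : R, 0 < C & forall phi (lam z : R),
    measurable_fun D phi -> (forall x, 0 <= phi x) -> 1 <= z ->
    (exists l, [/\ 0 < l, l < lam &
      (Int (fun x => log_bump p sigma (`|phi x| / l) * w x) <= 1)%E]) ->
    (Int (fun x => (0 < phi x)%R%:R * w x) <= (m * expR (- (2 * p * z)))%:E)%E ->
    (Int (fun x => phi x `^ p * w x) <= (C * z `^ (- sigma) * lam `^ p)%:E)%E.
Proof.
move=> p1 s0 m0; have p0 : 0 < p by exact: lt_trans p1.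
(* The first summand comes from the values below [l exp z], which contribute [m exp (- p z)], and
   [z^sigma exp (- p z) <= (2 sigma)^sigma]; the second comes from the Orlicz integral. *)
pose C := m * (2 * sigma) `^ sigma + 1.
have C0 : 0 < C by rewrite ltr_wpDl// mulr_ge0 ?powR_ge0 ?ltW.
exists C => // phi lam z mphi phi0 z1 [l [l0 llam Il]] Im.
have z0 : 0 < z by exact: lt_le_trans z1.
have lam0 : 0 < lam by exact: lt_trans llam.
have mpos : measurable_fun D (fun x => (0 < phi x)%R%:R * w x).
  apply: measurable_funMw; apply: measurable_fun_bool_real.
  by apply: measurable_fun_ltr => //; exact: measurable_cst.
have mN : measurable_fun D (fun x => log_bump p sigma (`|phi x| / l) * w x).
  apply: measurable_funMw; apply: measurable_log_bump.
  by apply: measurable_divr; exact: measurable_fun_norm.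
have mpp : measurable_fun D (fun x => phi x `^ p * w x).
  by apply: measurable_funMw; exact: measurable_fun_powRl.
have := @integral_le_lincomb _ _ _ mu D mD (fun x => phi x `^ p * w x)
  _ _ (lam `^ p * expR (p * z)) (lam `^ p * z `^ (- sigma)) _ _ mpp mpos mN.
move=> /(_ _ _ _ _ _ _ _ _ Im Il) H.
apply: (@le_trans _ _ _ _ _ (H _ _ _ _ _ _)); last first.
- rewrite lee_fin.
  rewrite [leLHS](_ : _ = lam `^ p * (m * expR (- (p * z)) + z `^ (- sigma))); last first.
    have -> : - (2 * p * z) = - (p * z) - p * z by ring.
    by rewrite expRD [expR (- (p * z))]expRN; field; rewrite gt_eqF// expR_gt0.
  rewrite mulrC ler_wpM2r ?powR_ge0// mulrDl mul1r lerD2r -mulrA ler_pM2l//.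
  rewrite powRN ler_pdivlMr ?powR_gt0// mulrC.
  rewrite expRN ler_pdivrMr ?expR_gt0//.
  rewrite (le_trans (powR_le_expR s0 (ltW z0)))// ler_wpM2l ?powR_ge0// ler_expR.
  by nra.
- move=> x Dx; rewrite !mulrA -mulrDl ler_wpM2r ?w0// -!mulrA -mulrDr.
  have [phi_gt0|phi_le0] := ltP 0 (phi x); last first.
    have -> : phi x = 0 by apply/eqP; rewrite eq_le phi_le0 phi0.
    by rewrite powR0 ?gt_eqF// mulr_ge0 ?powR_ge0// mulr0 add0r mulr_ge0 ?powR_ge0// log_bump_ge0.
  rewrite mulr1 (ger0_norm (phi0 x)).
  have sl : 0 <= phi x / l by rewrite divr_ge0// ltW.
  have := powR_log_bump p0 (ltW s0) sl z1.
  have -> : phi x `^ p = l `^ p * (phi x / l) `^ p.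
    by rewrite -powRM ?(ltW l0)// mulrC mulfVK// gt_eqF.
  move=> h; apply: (@le_trans _ _ (lam `^ p * (phi x / l) `^ p)).
    by rewrite ler_wpM2r ?powR_ge0// ler_wpowR ?(ltW p0) ?(ltW l0) ?(ltW llam).
  by rewrite ler_wpM2l ?powR_ge0.
- by rewrite mulr_ge0 ?powR_ge0.
- by rewrite mulr_ge0 ?powR_ge0 ?expR_ge0.
- by move=> x Dx; rewrite mulr_ge0 ?log_bump_ge0 ?w0.
- by move=> x Dx; rewrite mulr_ge0 ?w0.
- by move=> x Dx; rewrite mulr_ge0 ?powR_ge0 ?w0.
Qed.

(** On a set of measure [m exp (-2 p z)] the function [h] behaves as if bounded by a multiple of
    [lam z^(1/alpha)]: the larger values are charged to the Orlicz integral, which carries the same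
    factor [exp (-2 p z)]. *)
Lemma integral_powR_exp_bump (p alpha m : R) : 1 < p -> 0 < alpha -> 0 < m ->
  exists2 C : R, 0 < C & forall (P : T -> bool) h (lam z : R),
    measurable_fun D P -> measurable_fun D h -> 1 <= z ->
    (exists l, [/\ 0 < l, l < lam &
      (Int (fun x => exp_bump alpha (`|h x| / l) * w x) <= 1)%E]) ->
    (Int (fun x => (P x)%:R * w x) <= (m * expR (- (2 * p * z)))%:E)%E ->
    (Int (fun x => ((P x)%:R * `|h x|) `^ p * w x)
      <= ((C * (lam * z `^ alpha^-1 * expR (- (2 * z)))) `^ p)%:E)%E.
Proof.
move=> p1 a0 m0; have p0 : 0 < p by exact: lt_trans p1.
have [C C0 leC] := powR_exp_bump p1 a0.
exists ((C * (m + 1)) `^ p^-1); first by rewrite powR_gt0 ?mulr_gt0 ?addr_gt0.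
move=> P h lam z mP mh z1 [l [l0 llam Il]] Im.
have z0 : 0 < z by exact: lt_le_trans z1.
have lam0 : 0 < lam by exact: lt_trans llam.
have mpos : measurable_fun D (fun x => (P x)%:R * w x).
  by apply: measurable_funMw; exact: measurable_fun_bool_real.
have mN : measurable_fun D (fun x => exp_bump alpha (`|h x| / l) * w x).
  apply: measurable_funMw; apply: measurable_exp_bump.
  by apply: measurable_divr; exact: measurable_fun_norm.
have mpp : measurable_fun D (fun x => ((P x)%:R * `|h x|) `^ p * w x).
  apply: measurable_funMw; apply: measurable_fun_powRl; apply: measurable_funM.
    exact: measurable_fun_bool_real.
  exact: measurable_fun_norm.
have := @integral_le_lincomb _ _ _ mu D mD _ _ _ (lam `^ p * C * z `^ (p / alpha))
  (lam `^ p * C * expR (- (2 * p * z))) _ _ mpp mpos mN.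
move=> /(_ _ _ _ _ _ _ _ _ Im Il) H.
have zr1 : 1 <= z `^ (p / alpha).
  by rewrite -[leLHS](powRr0 z) ler_powR// divr_ge0 ?(ltW p0) ?(ltW a0).
apply: (@le_trans _ _ _ _ _ (H _ _ _ _ _ _)); last first.
- rewrite lee_fin.
  have Cm : 0 <= C * (m + 1) by rewrite mulr_ge0 ?addr_ge0 ?ltW.
  rewrite (powRM _ (powR_ge0 _ _) (_ : 0 <= lam * z `^ alpha^-1 * expR _)); last first.
    by rewrite !mulr_ge0 ?powR_ge0 ?expR_ge0 ?(ltW lam0).
  rewrite powRVK ?gt_eqF// (powRM _ (_ : 0 <= lam * _) (expR_ge0 _)); last first.
    by rewrite mulr_ge0 ?powR_ge0 ?(ltW lam0).
  rewrite (powRM _ (ltW lam0) (powR_ge0 _ _)) -powRrM (mulrC alpha^-1) -expRM.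
  have -> : - (2 * z) * p = - (2 * p * z) by ring.
  set e := expR _; have e0 : 0 <= e by exact: expR_ge0.
  set r := z `^ _ in zr1 *; set L := lam `^ p; have L0 : 0 <= L by exact: powR_ge0.
  rewrite [leRHS](_ : _ = L * C * r * (m * e) + L * C * e * r); last by ring.
  by rewrite lerD2l ler_wpM2l// !mulr_ge0// ltW.
- move=> x Dx; rewrite !mulrA -mulrDl ler_wpM2r ?w0//.
  case: (P x); last first.
    by rewrite mul0r powR0 ?gt_eqF// mulr0 add0r !mulr_ge0 ?powR_ge0 ?expR_ge0 ?exp_bump_ge0// ltW.
  rewrite mul1r mulr1 -!mulrA -!mulrDr.
  have sl : 0 <= `|h x| / l by rewrite divr_ge0// ltW.
  have -> : `|h x| `^ p = l `^ p * (`|h x| / l) `^ p.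
    by rewrite -powRM ?(ltW l0)// mulrC mulfVK// gt_eqF.
  apply: (@le_trans _ _ (lam `^ p * (`|h x| / l) `^ p)).
    by rewrite ler_wpM2r ?powR_ge0// ler_wpowR ?(ltW p0) ?(ltW l0) ?(ltW llam).
  by rewrite ler_wpM2l ?powR_ge0// (mulrA 2) leC.
- by rewrite !mulr_ge0 ?powR_ge0 ?expR_ge0// ltW.
- by rewrite !mulr_ge0 ?powR_ge0// ltW.
- by move=> x Dx; rewrite mulr_ge0 ?exp_bump_ge0 ?w0.
- by move=> x Dx; rewrite mulr_ge0 ?w0.
- by move=> x Dx; rewrite mulr_ge0 ?powR_ge0 ?w0.
Qed.

Lemma integral_Chebyshev (p k h A : R) psi : 0 < p -> k < h ->
  measurable_fun D psi ->
  (Int (fun x => (Num.max 0 (psi x - k)) `^ p * w x) <= (A `^ p)%:E)%E -> 0 <= A ->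
  (Int (fun x => (h < psi x)%R%:R * w x) <= ((A / (h - k)) `^ p)%:E)%E.
Proof.
move=> p0 kh mpsi I A0; have hk : 0 < h - k by rewrite subr_gt0.
have hkp : 0 < (h - k) `^ p by exact: powR_gt0.
rewrite mulrC powRM ?invr_ge0 ?(ltW hk)//.
have -> : (h - k)^-1 `^ p = ((h - k) `^ p)^-1.
  by rewrite -(powR_inv1 (ltW hk)) -powRrM mulN1r powRN.
apply: integral_le_scale I => //.
- apply: measurable_funMw; apply: measurable_fun_bool_real.
  by apply: measurable_fun_ltr => //; exact: measurable_cst.
- apply: measurable_funMw; apply: measurable_fun_powRl.
  apply: measurable_maxr; first exact: measurable_cst.
  by apply: measurable_funB => //; exact: measurable_cst.
- by move=> x Dx; rewrite mulr_ge0 ?w0.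
- by move=> x Dx; rewrite mulr_ge0 ?powR_ge0 ?w0.
- by rewrite invr_ge0 ltW.
move=> x Dx; rewrite mulrA ler_wpM2r ?w0// ler_pdivlMl//.
case: ltP => [hx|_]; last by rewrite mulr0 powR_ge0.
rewrite mulr1 max_r; last by rewrite subr_ge0 ltW// (lt_trans kh).
by rewrite ler_wpowR ?(ltW p0) ?(ltW hk)// lerD2r ltW.
Qed.

End weighted_estimates.

(** * Energy of a truncation *)

Section vector_fields.
Context (R : realType) (n : nat).
Local Notation V := 'rV[R]_n.+1.
Context (Omega : set V) (mO : measurable Omega).
Implicit Types (Q : V -> 'M[R]_n.+1) (F G : V -> V) (psi : V -> R).

Lemma measurable_dot F G : measurable_vf Omega F -> measurable_vf Omega G ->
  measurable_fun Omega (fun x => dot (F x) (G x)).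
Proof.
move=> mF mG; apply: measurable_sum => i.
exact: (measurable_funM (mF i) (mG i)).
Qed.

Lemma measurable_mxact Q G : measurable_mxf Omega Q -> measurable_vf Omega G ->
  measurable_vf Omega (fun x => mxact (Q x) (G x)).
Proof.
move=> mQ mG i.
rewrite (_ : (fun x => _) = fun x => \sum_j G x 0 j * Q x i j); last first.
  by apply/funext => x; rewrite !mxE; apply: eq_bigr => j _; rewrite mxE.
by apply: measurable_sum => j; exact: (measurable_funM (mG j) (mQ i j)).
Qed.

Lemma measurable_vfB F G : measurable_vf Omega F -> measurable_vf Omega G ->
  measurable_vf Omega (fun x => F x - G x).
Proof.
move=> mF mG i.
rewrite (_ : (fun x => _) = fun x => F x 0 i - G x 0 i); last first.
  by apply/funext => x; rewrite !mxE.
exact: (measurable_funB (mF i) (mG i)).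
Qed.

Lemma measurable_grad psi : Lip0 Omega psi -> measurable_vf Omega (grad psi).
Proof.
move=> /Lip0_continuous cpsi i.
rewrite (_ : (fun x => _) = fun x => 'D_(delta_mx 0 i) psi x); last first.
  by apply/funext => x; rewrite !mxE.
exact: measurable_funTS (derive_measurable _ cpsi).
Qed.

Lemma Lip0_measurable psi : Lip0 Omega psi -> measurable_fun Omega psi.
Proof. by move=> /Lip0_continuous/rV_continuous_measurable; exact: measurable_funTS. Qed.

Definition sqrtQ_norm Q G x := enorm (mxact (sqrtmx (Q x)) (G x)).

Context (Q : V -> 'M[R]_n.+1) (mQ : measurable_mxf Omega Q).
Context (symQ : forall x, Omega x -> sym_nonneg (Q x)).

(** The root [sqrtmx] is picked by choice, so its entries are not inspected: the squared norm equals
    the form [dot G (Q G)], which is measurable. *)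
Lemma measurable_sqrtQ_norm G :
  measurable_vf Omega G -> measurable_fun Omega (sqrtQ_norm Q G).
Proof.
move=> mG.
have mdot := measurable_fun_powRl 2^-1 (measurable_dot mG (measurable_mxact mQ mG)).
apply: eq_measurable_fun mdot.
move=> x; rewrite inE => Ox /=; rewrite /sqrtQ_norm /enorm dot_sqrtmx; last exact: symQ.
by rewrite powR12_sqrt//; exact: (symQ Ox).2.
Qed.

Section energy_of_truncation.
Context (p : R) (p1 : 1 < p) (psi : V -> R) (G : V -> V) (k g0 B : R).
Hypotheses (Lpsi : Lip0 Omega psi) (k0 : 0 <= k) (mG : measurable_vf Omega G).
Hypothesis IG : (\int[leb]_(x in Omega) (sqrtQ_norm Q G x `^ p)%:E <= g0%:E)%E.
Hypothesis ID : (\int[leb]_(x in Omega)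
  (sqrtQ_norm Q (fun x => (grad psi x - G x)%R) x `^ p)%:E <= B%:E)%E.

Let p0 : 0 < p. Proof. exact: lt_trans p1. Qed.

Let mgrad := measurable_grad Lpsi.
Let mtrunc := measurable_grad (Lip0_trunc k0 Lpsi).
Let mdiff := measurable_vfB mgrad mG.
Let mpow F (mF : measurable_vf Omega F) :
  measurable_fun Omega (fun x => sqrtQ_norm Q F x `^ p).
Proof. exact: measurable_fun_powRl (measurable_sqrtQ_norm mF). Qed.
Let pow0 F x : Omega x -> 0 <= sqrtQ_norm Q F x `^ p.
Proof. by move=> _; exact: powR_ge0. Qed.

Let gradE x : grad (trunc k psi) x = if k < psi x then grad psi x else 0.
Proof. by rewrite grad_trunc//; exact: (Lip0_continuous Lpsi). Qed.

Let sqrtQ_trunc0 x : psi x <= k -> sqrtQ_norm Q (grad (trunc k psi)) x = 0.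
Proof.
by move=> kx; rewrite /sqrtQ_norm gradE ltNge kx/= mxact0 /enorm dot0l sqrtr0.
Qed.

(** Serves for finiteness and integrability only: the bound involves the energy [g0] of [G], which
    must not enter the constants. *)
Lemma energy_trunc_crude : (\int[leb]_(x in Omega)
  (sqrtQ_norm Q (grad (trunc k psi)) x `^ p)%:E
    <= (2 `^ p * g0 + 2 `^ p * B)%:E)%E.
Proof.
have c0 : 0 <= 2 `^ p :> R by exact: powR_ge0.
refine (integral_le_lincomb mO (mpow mtrunc) (mpow mG) (mpow mdiff)
  (@pow0 _) (@pow0 _) (@pow0 _) c0 c0 _ IG ID).
move=> x Ox; have [kx|kx] := ltP k (psi x); last first.
  rewrite sqrtQ_trunc0 ?powR0 ?gt_eqF//.
  by rewrite addr_ge0// mulr_ge0 ?powR_ge0.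
rewrite /sqrtQ_norm gradE kx -mulrDr.
apply: le_trans (powRD_le (ltW p0) (enorm_ge0 _) (enorm_ge0 _)).
rewrite ler_wpowR ?enorm_ge0 ?(ltW p0)// mxactB; exact: enormB_le.
Qed.

(** Where [psi > k] the gradient of the truncation is [grad psi], and [enorm_powR_energy] compares
    it with [G]; elsewhere both it and the energy density vanish. *)
Lemma energy_trunc_le A : (energy_form Omega p Q G (trunc k psi) <= A%:E)%E ->
  (\int[leb]_(x in Omega) (sqrtQ_norm Q (grad (trunc k psi)) x `^ p)%:E
    <= (2 * 2 `^ p * A + 2 `^ p * (2 `^ p + 1) * B)%:E)%E.
Proof.
move=> IA.
have c1 : 0 <= 2 * 2 `^ p :> R by rewrite mulr_ge0 ?powR_ge0.
have c2 : 0 <= 2 `^ p * (2 `^ p + 1) :> R by rewrite mulr_ge0 ?addr_ge0 ?powR_ge0.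
have me : measurable_fun Omega (fun x => sqrtQ_norm Q G x `^ (p - 2)
    * dot (grad (trunc k psi) x) (mxact (Q x) (G x))).
  have m1 := measurable_fun_powRl (p - 2) (measurable_sqrtQ_norm mG).
  exact: (measurable_funM m1 (measurable_dot mtrunc (measurable_mxact mQ mG))).
have msum : measurable_fun Omega (fun x =>
    sqrtQ_norm Q G x `^ p + sqrtQ_norm Q (grad (trunc k psi)) x `^ p).
  exact: (measurable_funD (mpow mG) (mpow mtrunc)).
have Isum : (\int[leb]_(x in Omega)
    (sqrtQ_norm Q G x `^ p + sqrtQ_norm Q (grad (trunc k psi)) x `^ p)%:E
    <= (1 * g0 + 1 * (2 `^ p * g0 + 2 `^ p * B))%:E)%E.
  refine (integral_le_lincomb mO msum (mpow mG) (mpow mtrunc) _ (@pow0 _) (@pow0 _)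
    ler01 ler01 _ IG energy_trunc_crude).
    by move=> x Ox; apply: addr_ge0; exact: powR_ge0.
  by move=> x Ox; rewrite !mul1r.
have ie : leb.-integrable Omega (EFin \o (fun x => sqrtQ_norm Q G x `^ (p - 2)
    * dot (grad (trunc k psi) x) (mxact (Q x) (G x)))).
  refine (integrable_dominated mO me msum _ Isum).
  move=> x Ox; rewrite -dot_sqrtmx; last exact: symQ.
  exact: normr_energy_le.
refine (integral_le_signed mO (mpow mtrunc) (mpow mdiff) (@pow0 _) (@pow0 _)
  c1 c2 ie _ IA ID).
move=> x Ox; have [kx|kx] := ltP k (psi x); last first.
  rewrite sqrtQ_trunc0 ?powR0 ?gt_eqF//.
  rewrite gradE ltNge kx /= dot0l !mulr0 add0r.
  by rewrite mulr_ge0 ?powR_ge0.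
rewrite -dot_sqrtmx; last exact: symQ.
rewrite /sqrtQ_norm gradE kx mxactB.
exact: enorm_powR_energy.
Qed.

End energy_of_truncation.
End vector_fields.

(** * One step of the iteration, for a Lipschitz function *)

Section truncation_decay.
Context (R : realType) (n : nat).
Local Notation V := 'rV[R]_n.+1.
Context (Omega : set V) (mO : measurable Omega) (v : V -> R) (wv : weight Omega v).
Context (p sigma alpha beta S Ct m : R).
Hypotheses (p1 : 1 < p) (sigma0 : 0 < sigma) (alpha0 : 0 < alpha) (beta0 : 0 < beta).
Hypotheses (alphaP : (p - 1) / alpha <= sigma / p) (S0 : 0 < S) (m0 : 0 < m).
Implicit Types (phi psi f g : V -> R) (G t : V -> V) (Q : V -> 'M[R]_n.+1).

Let p0 : 0 < p. Proof. exact: lt_trans p1. Qed.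
Let mv : measurable_fun Omega v. Proof. by have [] := wv. Qed.
Let v0 x : Omega x -> 0 <= v x. Proof. by have [_] := wv; apply. Qed.

Lemma QLp_norm_le Q G (E : R) : 0 <= E ->
  (\int[leb]_(x in Omega) (sqrtQ_norm Q G x `^ p)%:E <= (E `^ p)%:E)%E ->
  (QLp_norm Omega Q p G <= E%:E)%E.
Proof.
move=> E0 IE; rewrite /QLp_norm le_poweRV//.
by apply: integral_ge0 => x Ox; rewrite lee_fin powR_ge0.
Qed.

Lemma measurable_trunc k psi : measurable_fun Omega psi ->
  measurable_fun Omega (trunc k psi).
Proof.
move=> mpsi; have mk : measurable_fun Omega (cst k : V -> R) by exact: measurable_cst.
have m00 : measurable_fun Omega (cst 0 : V -> R) by exact: measurable_cst.
exact: (measurable_maxr m00 (measurable_funB mpsi mk)).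
Qed.

Lemma measurable_gt k psi : measurable_fun Omega psi ->
  measurable_fun Omega (fun x => k < psi x).
Proof.
move=> mpsi; have mk : measurable_fun Omega (cst k : V -> R) by exact: measurable_cst.
exact: (measurable_fun_ltr mk mpsi).
Qed.

Lemma trunc_gt0 k psi x : (0 < trunc k psi x) = (k < psi x).
Proof. by rewrite lt_neqAle eq_sym trunc_eq0 trunc_ge0 andbT -ltNge. Qed.

Lemma Sobolev_estimate : exists2 c : R, 0 < c &
  forall Q psi k (z E : R), sobolev Omega v Q p (log_bump p sigma) S ->
    Lip0 Omega psi -> 0 <= k -> 1 <= z -> 0 < E ->
    (\int[leb]_(x in Omega) ((k < psi x)%R%:R * v x)%:E
       <= (m * expR (- (2 * p * z)))%:E)%E ->
    (\int[leb]_(x in Omega) (sqrtQ_norm Q (grad (trunc k psi)) x `^ p)%:E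
       <= (E `^ p)%:E)%E ->
    (\int[leb]_(x in Omega) (trunc k psi x `^ p * v x)%:E
       <= ((c * z `^ (- (sigma / p)) * E) `^ p)%:E)%E.
Proof.
have [C C0 HC] := integral_powR_log_bump leb mO mv v0 p1 sigma0 m0.
exists (C `^ p^-1 * (2 * S)); first by rewrite !mulr_gt0 ?powR_gt0.
move=> Q psi k z E sob Lpsi k0 z1 E0 Im IE.
have SE : 0 < S * E by rewrite mulr_gt0.
(* The factor 2 makes the inequality strict, so that an admissible scale below [2 S E] exists. *)
have Orl : (Orlicz_norm Omega v (log_bump p sigma) (trunc k psi) < (2 * S * E)%:E)%E.
  apply: le_lt_trans (sob _ (Lip0_trunc k0 Lpsi)) _.
  apply: (@le_lt_trans _ _ (S%:E * E%:E)%E).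
    by apply: lee_wpmul2l; [rewrite lee_fin ltW|apply: QLp_norm_le => //; exact: ltW].
  by rewrite -EFinM lte_fin; lra.
have := HC _ _ z (measurable_trunc k (Lip0_measurable Lpsi)) (trunc_ge0 k psi)
  z1 (Orlicz_norm_lt Orl).
have -> : (\int[leb]_(x in Omega) ((0 < trunc k psi x)%R%:R * v x)%:E =
           \int[leb]_(x in Omega) ((k < psi x)%R%:R * v x)%:E)%E.
  by apply: eq_integral => x _; rewrite trunc_gt0.
move=> /(_ Im).
have z0 : 0 <= z by exact: le_trans z1.
suff -> : (C `^ p^-1 * (2 * S) * z `^ (- (sigma / p)) * E) `^ p
    = C * z `^ (- sigma) * (2 * S * E) `^ p by [].
have SE2 : 0 <= 2 * S * E by rewrite !mulr_ge0 ?(ltW S0) ?(ltW E0).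
have -> : C `^ p^-1 * (2 * S) * z `^ (- (sigma / p)) * E
    = C `^ p^-1 * (z `^ (- (sigma / p)) * (2 * S * E)) by ring.
rewrite (powRM _ (powR_ge0 _ _) (mulr_ge0 (powR_ge0 _ _) SE2)).
rewrite (powRM _ (powR_ge0 _ _) SE2) powRVK ?gt_eqF ?(ltW C0)//.
by rewrite -powRrM mulNr mulfVK ?gt_eqF// mulrA.
Qed.

(** The data form with absolute values inside; insensitive to signs, it serves sub- and
    supersolutions alike. *)
Definition data_bound t f g phi : \bar R :=
  (\int[leb]_(x in Omega) ((`|f x| `^ (p - 1) * phi x
     + `|g x| `^ (p - 1) * `|dot (t x) (grad phi x)|) * v x)%:E)%E.

(** Hoelder on the level set, where both data are exponentially small in norm. The term with [f] is
    paired with the truncation, controlled by [Sobolev_estimate]; the term with [g] with its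
    derivative along [t], controlled by the subunit property. *)
Lemma data_estimate : 0 < Ct -> exists2 c : R, 0 < c &
  forall Q t psi k f g (M z E : R), sobolev Omega v Q p (log_bump p sigma) S ->
    subunit Omega v Q p t Ct ->
    measurable_fun Omega f -> measurable_fun Omega g ->
    (Orlicz_norm Omega v (exp_bump alpha) f < M%:E)%E ->
    (Orlicz_norm Omega v (exp_bump beta) g < M%:E)%E -> 0 < M ->
    Lip0 Omega psi -> 0 <= k -> 1 <= z -> 0 < E ->
    (\int[leb]_(x in Omega) ((k < psi x)%R%:R * v x)%:E
       <= (m * expR (- (2 * p * z)))%:E)%E ->
    (\int[leb]_(x in Omega) (sqrtQ_norm Q (grad (trunc k psi)) x `^ p)%:E
       <= (E `^ p)%:E)%E ->
    (data_bound t f g (trunc k psi)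
       <= (c * (M * z `^ beta^-1 * expR (- (2 * z))) `^ (p - 1) * E)%:E)%E.
Proof.
move=> Ct0.
have [c1 c10 Hc1] := Sobolev_estimate.
have [C2 C20 HC2] := integral_powR_exp_bump leb mO mv v0 p1 alpha0 m0.
have [C3 C30 HC3] := integral_powR_exp_bump leb mO mv v0 p1 beta0 m0.
pose c := 2 * C2 `^ (p - 1) * c1 + 2 * C3 `^ (p - 1) * Ct.
exists c; first by rewrite addr_gt0 ?mulr_gt0 ?powR_gt0.
move=> Q t psi k f g M z E sob [mt _ sub] mf mg fM gM M0 Lpsi k0 z1 E0 Im IE.
have z0 : 0 < z by exact: lt_le_trans z1.
have mpsi := Lip0_measurable Lpsi.
have Lphi := Lip0_trunc k0 Lpsi.
have mphi := measurable_trunc k mpsi.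
have mT := measurable_fun_norm (measurable_dot mt (measurable_grad Lphi)).
have mchi := @measurable_fun_bool_real _ _ R _ _ (measurable_gt k mpsi).
have mcf := measurable_funM mchi (measurable_fun_norm mf).
have mcg := measurable_funM mchi (measurable_fun_norm mg).
have If := HC2 _ _ _ _ (measurable_gt k mpsi) mf z1 (Orlicz_norm_lt fM) Im.
have Ig := HC3 _ _ _ _ (measurable_gt k mpsi) mg z1 (Orlicz_norm_lt gM) Im.
have Iphi := Hc1 _ _ _ _ _ sob Lpsi k0 z1 E0 Im IE.
have IT : (\int[leb]_(x in Omega) (`|dot (t x) (grad (trunc k psi) x)| `^ p * v x)%:E
    <= ((Ct * E) `^ p)%:E)%E.
  rewrite -le_poweRV// ?mulr_ge0 ?(ltW Ct0) ?(ltW E0)//; last first.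
    by apply: integral_ge0 => x Ox; rewrite lee_fin mulr_ge0 ?powR_ge0 ?v0.
  apply: le_trans (sub _ Lphi) _; rewrite EFinM; apply: lee_wpmul2l.
    by rewrite lee_fin ltW.
  by apply: QLp_norm_le => //; exact: ltW.
have chi0 x : Omega x -> forall h : V -> R, 0 <= (k < psi x)%R%:R * `|h x|.
  by move=> _ h; rewrite mulr_ge0.
have A20 : 0 < C2 * (M * z `^ alpha^-1 * expR (- (2 * z))).
  by rewrite !mulr_gt0 ?powR_gt0 ?expR_gt0.
have A30 : 0 < C3 * (M * z `^ beta^-1 * expR (- (2 * z))).
  by rewrite !mulr_gt0 ?powR_gt0 ?expR_gt0.
have B20 : 0 < c1 * z `^ (- (sigma / p)) * E by rewrite !mulr_gt0 ?powR_gt0.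
have B30 : 0 < Ct * E by rewrite mulr_gt0.
have norm0 x : Omega x -> 0 <= `|dot (t x) (grad (trunc k psi) x)| by [].
have tr0 x : Omega x -> 0 <= trunc k psi x by move=> _; exact: trunc_ge0.
have I1 := integral_crude_Hoelder mO p1 mcf mphi mv (fun x Ox => chi0 x Ox f) tr0 v0
  A20 B20 If Iphi.
have I2 := integral_crude_Hoelder mO p1 mcg mT mv (fun x Ox => chi0 x Ox g) norm0 v0
  A30 B30 Ig IT.
have m1 := measurable_funM (measurable_funM (measurable_fun_powRl (p - 1) mcf) mphi) mv.
have m2 := measurable_funM (measurable_funM (measurable_fun_powRl (p - 1) mcg) mT) mv.
have m3 := measurable_funM (measurable_funD
  (measurable_funM (measurable_fun_powRl (p - 1) (measurable_fun_norm mf)) mphi)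
  (measurable_funM (measurable_fun_powRl (p - 1) (measurable_fun_norm mg)) mT)) mv.
have H := @integral_le_lincomb _ _ _ leb Omega mO _ _ _ 1 1 _ _ m3 m1 m2 _ _ _
  ler01 ler01 _ I1 I2.
apply: le_trans (H _ _ _ _) _.
- move=> x Ox /=; rewrite mulr_ge0 ?v0// addr_ge0// mulr_ge0 ?powR_ge0//.
  exact: trunc_ge0.
- move=> x Ox /=; rewrite mulr_ge0 ?v0// mulr_ge0 ?powR_ge0//; exact: trunc_ge0.
- by move=> x Ox /=; rewrite mulr_ge0 ?v0// mulr_ge0 ?powR_ge0.
- move=> x Ox /=; rewrite !mul1r -mulrDl ler_wpM2r ?v0//.
  rewrite grad_trunc; last exact: (Lip0_continuous Lpsi).
  have [kx|kx] := ltP k (psi x); first by rewrite !mul1r.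
  have -> : trunc k psi x = 0 by apply/eqP; rewrite trunc_eq0.
  by rewrite dotC dot0l normr0 !mulr0.
rewrite lee_fin !mul1r; set e := expR _; have e0 : 0 <= e by exact: expR_ge0.
set K := (M * z `^ beta^-1 * e) `^ (p - 1).
have zb1 : 1 <= z `^ beta^-1.
  by rewrite -[leLHS](powRr0 z) ler_powR// invr_ge0 ltW.
have K3 : (C3 * (M * z `^ beta^-1 * e)) `^ (p - 1) = C3 `^ (p - 1) * K.
  by rewrite powRM ?(ltW C30) ?mulr_ge0 ?powR_ge0 ?(ltW M0).
(* Here [alphaP] acts: the total power of [z] in the term with [f] is nonpositive, so this term is
   dominated by the one with [g]. *)
have K2 : (C2 * (M * z `^ alpha^-1 * e)) `^ (p - 1) * z `^ (- (sigma / p))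
    <= C2 `^ (p - 1) * K.
  have Me : 0 <= M * e by rewrite mulr_ge0 ?(ltW M0).
  have -> : C2 * (M * z `^ alpha^-1 * e) = C2 * (M * e) * z `^ alpha^-1 by ring.
  rewrite (powRM _ (mulr_ge0 (ltW C20) Me) (powR_ge0 _ _)).
  rewrite -powRrM -mulrA -powRD; last by rewrite (gt_eqF z0) implybT.
  have zz : z `^ (alpha^-1 * (p - 1) + - (sigma / p)) <= 1.
    rewrite -[leRHS](powRr0 z) ler_powR//.
    by rewrite mulrC subr_le0.
  apply: le_trans (ler_wpM2l (powR_ge0 _ _) zz) _; rewrite mulr1.
  rewrite (powRM _ (ltW C20) Me) ler_wpM2l ?powR_ge0// ler_wpowR//.
    by rewrite subr_ge0 ltW.
  by rewrite mulrAC ler_peMr.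
have := ler_wpM2l (ltW (mulr_gt0 c10 E0)) K2; rewrite K3 /c; clear K2 K3.
clearbody K.
move: (C2 `^ (p - 1)) (C3 `^ (p - 1)) (_ `^ (p - 1)) (z `^ (- _)) => X2 X3 Y Z hh.
rewrite [leLHS](_ : _ = 2 * (c1 * E * (Y * Z)) + 2 * (X3 * K * (Ct * E))); last by ring.
rewrite [leRHS](_ : _ = 2 * (c1 * E * (X2 * K)) + 2 * (X3 * K * (Ct * E))); last by ring.
by rewrite lerD2r ler_pM2l.
Qed.

(** The energy norm [E] of the truncation satisfies [E^p <= b kappa^(p-1) E + b' kappa^p]. Either
    [E <= kappa], or the error term is at most [b' kappa^(p-1) E] and division by [E] gives
    [E <= (b + b')^(1/(p-1)) kappa]. The Sobolev estimate then turns [kappa] into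
    [M z^(-theta) exp (-2 z)]. *)
Lemma trunc_Lp_decay : 0 < Ct -> exists2 c : R, 0 < c &
  forall Q t psi G k f g (M z g0 : R),
    measurable_mxf Omega Q -> (forall x, Omega x -> sym_nonneg (Q x)) ->
    sobolev Omega v Q p (log_bump p sigma) S -> subunit Omega v Q p t Ct ->
    measurable_fun Omega f -> measurable_fun Omega g ->
    (Orlicz_norm Omega v (exp_bump alpha) f < M%:E)%E ->
    (Orlicz_norm Omega v (exp_bump beta) g < M%:E)%E -> 0 < M ->
    Lip0 Omega psi -> measurable_vf Omega G -> 0 <= k -> 1 <= z ->
    (\int[leb]_(x in Omega) (sqrtQ_norm Q G x `^ p)%:E <= g0%:E)%E ->
    (\int[leb]_(x in Omega) (sqrtQ_norm Q (fun x => (grad psi x - G x)%R) x `^ p)%:E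
       <= ((M * z `^ beta^-1 * expR (- (2 * z))) `^ p)%:E)%E ->
    (energy_form Omega p Q G (trunc k psi) <= data_bound t f g (trunc k psi))%E ->
    (\int[leb]_(x in Omega) ((k < psi x)%R%:R * v x)%:E
       <= (m * expR (- (2 * p * z)))%:E)%E ->
    (\int[leb]_(x in Omega) (trunc k psi x `^ p * v x)%:E
       <= ((c * (M * z `^ (- (sigma / p - beta^-1)) * expR (- (2 * z)))) `^ p)%:E)%E.
Proof.
move=> Ct0; have [c1 c10 Hc1] := Sobolev_estimate.
have [c4 c40 Hc4] := data_estimate Ct0.
pose b := 2 * 2 `^ p * c4; pose b' := 2 `^ p * (2 `^ p + 1) : R.
have b0 : 0 < b by rewrite !mulr_gt0 ?powR_gt0.
have b'0 : 0 < b' by rewrite mulr_gt0 ?addr_gt0 ?powR_gt0.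
pose c5 := 1 + (b + b') `^ (p - 1)^-1.
have c51 : 1 <= c5 by rewrite lerDl powR_ge0.
have c50 : 0 < c5 by exact: lt_le_trans c51.
exists (c1 * c5); first by rewrite mulr_gt0.
move=> Q t psi G k f g M z g0 mQ symQ sob subu mf mg fM gM M0 Lpsi mG k0 z1 IG ID Ien Im.
have z0 : 0 < z by exact: lt_le_trans z1.
pose kappa := M * z `^ beta^-1 * expR (- (2 * z)).
have kappa0 : 0 < kappa by rewrite !mulr_gt0 ?powR_gt0 ?expR_gt0.
have crude := energy_trunc_crude mO mQ symQ p1 Lpsi k0 mG IG ID.
(* Dividing by the energy requires it to be finite, which is what the crude bound supplies. *)
have [r r0 Ir] : exists2 r : R, 0 <= r & (\int[leb]_(x in Omega)
    (sqrtQ_norm Q (grad (trunc k psi)) x `^ p)%:E)%E = r%:E.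
  have I0 : (0 <= \int[leb]_(x in Omega)
      (sqrtQ_norm Q (grad (trunc k psi)) x `^ p)%:E)%E.
    by apply: integral_ge0 => x Ox; rewrite lee_fin powR_ge0.
  move: I0 crude; case: (integral _ _ _) => [r|//|//].
  by rewrite lee_fin => r0 _; exists r.
have rV0 : 0 <= r `^ p^-1 by exact: powR_ge0.
suff le_r : r `^ p^-1 <= c5 * kappa.
  have E0 : 0 < c5 * kappa by rewrite mulr_gt0.
  have IE : (\int[leb]_(x in Omega) (sqrtQ_norm Q (grad (trunc k psi)) x `^ p)%:E
      <= ((c5 * kappa) `^ p)%:E)%E.
    rewrite Ir lee_fin -[leLHS](powRVK (_ : p != 0) r0) ?gt_eqF//.
    by rewrite ler_wpowR// ltW.
  have := Hc1 _ _ _ _ _ sob Lpsi k0 z1 E0 Im IE.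
  suff -> : c1 * c5 * (M * z `^ (- (sigma / p - beta^-1)) * expR (- (2 * z)))
    = c1 * z `^ (- (sigma / p)) * (c5 * kappa) by [].
  rewrite opprB addrC powRD; last by rewrite (gt_eqF z0) implybT.
  by rewrite /kappa; ring.
have [r_le|r_gt] := leP (r `^ p^-1) kappa.
  by rewrite (le_trans r_le)// ler_peMl// ltW.
have rV1 : 0 < r `^ p^-1 by exact: lt_trans r_gt.
set E := r `^ p^-1 in rV1 r_gt rV0 *.
have rE : r = E `^ p by rewrite powRVK ?gt_eqF.
have IE : (\int[leb]_(x in Omega) (sqrtQ_norm Q (grad (trunc k psi)) x `^ p)%:E
    <= (E `^ p)%:E)%E by rewrite Ir rE.
have Idata := Hc4 _ _ _ _ _ _ _ _ _ sob subu mf mg fM gM M0 Lpsi k0 z1 rV1 Im IE.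
have := energy_trunc_le mO mQ symQ p1 Lpsi k0 mG IG ID (le_trans Ien Idata).
rewrite Ir rE lee_fin -/kappa => h.
have : E <= (b + b') `^ (p - 1)^-1 * kappa.
  apply: powR_le_absorb => //; first exact: addr_gt0.
  apply: le_trans h _; rewrite -(powR_subr1M p0 (ltW kappa0)) -/b'.
  have K0 : 0 < kappa `^ (p - 1) by exact: powR_gt0.
  set K := kappa `^ (p - 1) in K0 *.
  rewrite [leRHS](_ : _ = 2 * 2 `^ p * (c4 * K * E) + b' * (K * E)); last first.
    by rewrite /b; ring.
  by rewrite lerD2l ler_pM2l// ler_pM2l// ltW.
by move=> /le_trans; apply; rewrite ler_pM2r// lerDr.
Qed.

End truncation_decay.

(** * Decay of level sets *)

Section level_sets.
Context d (T : measurableType d) (R : realType) (mu : {measure set T -> \bar R}).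
Context (D : set T) (mD : measurable D) (w : T -> R).
Hypotheses (mw : measurable_fun D w) (w0 : forall x, D x -> 0 <= w x).
Implicit Types (u psi : T -> R).
Local Notation "'Int' F" := (\int[mu]_(x in D) (F x)%:E)%E (at level 10, F at level 9).

Let mgt k u : measurable_fun D u -> measurable_fun D (fun x => (k < u x)%R%:R * w x).
Proof.
move=> mu'; apply: measurable_funMw => //; apply: measurable_fun_bool_real.
by apply: measurable_fun_ltr => //; exact: measurable_cst.
Qed.

Let mfar (e : R) u psi : measurable_fun D u -> measurable_fun D psi ->
  measurable_fun D (fun x => (e <= `|psi x - u x|)%R%:R * w x).
Proof.
move=> mu' mpsi; apply: measurable_funMw => //; apply: measurable_fun_bool_real.
apply: measurable_fun_ler; first exact: measurable_cst.
by apply: measurable_fun_norm; exact: measurable_funB.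
Qed.

Let pos (P : T -> bool) x : D x -> 0 <= (P x)%:R * w x.
Proof. by move=> Dx; rewrite mulr_ge0 ?w0. Qed.

(** Where [psi > h], either [u > k] or [psi] and [u] differ by at least [e]. *)
Lemma level_shift (k h e A B : R) u psi : measurable_fun D u -> measurable_fun D psi ->
  k + e <= h ->
  (Int (fun x => (k < u x)%R%:R * w x) <= A%:E)%E ->
  (Int (fun x => (e <= `|psi x - u x|)%R%:R * w x) <= B%:E)%E ->
  (Int (fun x => (h < psi x)%R%:R * w x) <= (A + B)%:E)%E.
Proof.
move=> mu' mpsi keh IA IB; rewrite -[A]mul1r -[B]mul1r.
refine (integral_le_lincomb mD (mgt _ mpsi) (mgt _ mu') (mfar _ mu' mpsi)
  (pos _) (pos _) (pos _) ler01 ler01 _ IA IB).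
move=> x Dx; rewrite !mul1r -mulrDl ler_wpM2r ?w0// -natrD ler_nat.
case: (ltP k (u x)) => uk; first by case: (h < _).
have [hpsi|//] := ltP h (psi x); suff -> : e <= `|psi x - u x| by [].
by rewrite (le_trans _ (ler_norm _))//; lra.
Qed.

Lemma Chebyshev_distance (p delta eta : R) u psi : 0 < p -> 0 < delta -> 0 < eta ->
  measurable_fun D u -> measurable_fun D psi ->
  (Int (fun x => `|psi x - u x| `^ p * w x) <= ((delta * eta `^ p^-1) `^ p)%:E)%E ->
  (Int (fun x => (delta <= `|psi x - u x|)%R%:R * w x) <= eta%:E)%E.
Proof.
move=> p0 d0 e0 mu' mpsi I; have dp : 0 < delta `^ p by exact: powR_gt0.
have -> : eta = (delta `^ p)^-1 * (delta * eta `^ p^-1) `^ p.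
  by rewrite (powRM _ (ltW d0) (powR_ge0 _ _)) powRVK ?gt_eqF ?(ltW e0)// mulKf ?gt_eqF.
have mpow : measurable_fun D (fun x => `|psi x - u x| `^ p * w x).
  apply: measurable_funMw => //; apply: measurable_fun_powRl; apply: measurable_fun_norm.
  exact: measurable_funB.
refine (integral_le_scale mD (mfar _ mu' mpsi) mpow (pos _) _ _ _ I).
- by move=> x Dx; rewrite mulr_ge0 ?powR_ge0 ?w0.
- by rewrite invr_ge0 ltW.
move=> x Dx; rewrite mulrA ler_wpM2r ?w0// ler_pdivlMl//.
have [h|_] := leP delta; last by rewrite mulr0 powR_ge0.
by rewrite mulr1 ler_wpowR ?(ltW p0) ?(ltW d0).
Qed.

(** Transfers the one-step estimate from [psi j] to [u]: go over to a level of [psi j], apply the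
    estimate and Chebyshev there, and return to [u], each passage costing a small shift of level and
    a set of small measure. *)
Lemma level_decay (p m : R) (K : R -> R) u (psi : nat -> T -> R) :
  0 < p -> 0 < m -> (forall z, 1 <= z -> 0 <= K z) ->
  measurable_fun D u -> (forall j, measurable_fun D (psi j)) ->
  (forall e, 0 < e -> \forall j \near \oo,
     (Int (fun x => `|psi j x - u x| `^ p * w x) <= (e `^ p)%:E)%E) ->
  (forall k z, 0 <= k -> 1 <= z -> \forall j \near \oo,
     (Int (fun x => (k < psi j x)%R%:R * w x) <= (2 * m * expR (- (2 * p * z)))%:E ->
      Int (fun x => (Num.max 0 (psi j x - k)) `^ p * w x) <= ((K z) `^ p)%:E)%E) ->
  forall k h z, 0 <= k -> k < h -> 1 <= z ->
    (Int (fun x => (k < u x)%R%:R * w x) <= (m * expR (- (2 * p * z)))%:E)%E ->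
    (Int (fun x => (h < u x)%R%:R * w x) <= ((K z / ((h - k) / 2)) `^ p)%:E)%E.
Proof.
move=> p0 m0 K0 mu' mpsi cvg_psi step k h z k0 kh z1 Ik.
(* One quarter of the gap is spent going from [u] to [psi j], one coming back; half is left for
   Chebyshev. *)
pose e := (h - k) / 4; have e0 : 0 < e by rewrite divr_gt0 ?subr_gt0.
set m' := m * expR _ in Ik; have m'0 : 0 < m' by rewrite mulr_gt0 ?expR_gt0.
(* [eta <= m'] keeps the level set of [psi j] within twice the assumed measure, the room given by
   [2 * m] in the hypothesis; [eta <= r] bounds the final error. *)
apply/lee_addgt0Pr => r r0; pose eta := Num.min r m'.
have eta0 : 0 < eta by rewrite lt_min r0.
near \oo => j.
have far : (Int (fun x => (e <= `|psi j x - u x|)%R%:R * w x) <= eta%:E)%E.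
  apply: (@Chebyshev_distance p) => //; near: j; apply: cvg_psi.
  by rewrite mulr_gt0 ?powR_gt0.
have lo : (Int (fun x => (k + e < psi j x)%R%:R * w x)
    <= (2 * m * expR (- (2 * p * z)))%:E)%E.
  apply: le_trans (level_shift mu' (mpsi j) (lexx _) Ik far) _.
  by rewrite lee_fin -mulrA mulr_natl mulr2n lerD2l /eta ge_min lexx orbT.
have tr : (Int (fun x => (Num.max 0 (psi j x - (k + e))) `^ p * w x) <= ((K z) `^ p)%:E)%E.
  by move: lo; near: j; apply: step => //; rewrite addr_ge0// ltW.
have kh' : k + e < h - e by rewrite /e; lra.
have hi := integral_Chebyshev mD mw w0 p0 kh' (mpsi j) tr (K0 z z1).
have far' : (Int (fun x => (e <= `|u x - psi j x|)%R%:R * w x) <= eta%:E)%E.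
  by under eq_integral do rewrite distrC.
have := level_shift (mpsi j) mu' (_ : h - e + e <= h) hi far'.
rewrite subrK lexx => /(_ isT) /le_trans; apply.
rewrite -EFinD lee_fin; have -> : h - e - (k + e) = (h - k) / 2 by rewrite /e; field.
by rewrite lerD2l ge_min lexx.
Unshelve. all: by end_near. Qed.

(* The levels are [k(z) = c'' M (1 - z^(-eps))] with [eps = theta - 1], for which
   [k(z+1) - k(z)] is comparable to [M z^(-theta)]. *)
Lemma level_iteration (p m c theta : R) : 1 < p -> 0 < m -> 0 < c -> 1 < theta ->
  exists2 c' : R, 0 < c' & forall u (M : R), 0 < M -> measurable_fun D u ->
    (Int w <= (m * expR (- (2 * p * 1)))%:E)%E ->
    (forall k h z, 0 <= k -> k < h -> 1 <= z ->
      (Int (fun x => (k < u x)%R%:R * w x) <= (m * expR (- (2 * p * z)))%:E)%E ->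
      (Int (fun x => (h < u x)%R%:R * w x)
        <= ((c * (M * z `^ (- theta) * expR (- (2 * z))) / ((h - k) / 2)) `^ p)%:E)%E) ->
    (Int (fun x => (c' * M < u x)%R%:R * w x) <= 0)%E.
Proof.
move=> p1 m0 c0 theta1; have p0 : 0 < p by exact: lt_trans p1.
pose eps := theta - 1; have eps0 : 0 < eps by rewrite subr_gt0.
have thetaE : theta = eps + 1 by rewrite /eps subrK.
pose q := eps * 2 `^ (- theta); have q0 : 0 < q by rewrite mulr_gt0 ?powR_gt0.
pose mp := m `^ p^-1; have mp0 : 0 < mp by exact: powR_gt0.
(* Chosen so that the Chebyshev quotient, with the gap at least [c' M q z^(-theta)], is at most
   [mp exp (-2 z) exp (-2)], whose [p]-th power is [m exp (-2 p (z + 1))]. *)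
pose c' := 2 * c * expR 2 / (mp * q).
have c'0 : 0 < c' by rewrite divr_gt0 ?mulr_gt0 ?expR_gt0.
exists c' => // u M M0 mu' Iw step.
pose k (z : R) := c' * M * (1 - z `^ (- eps)).
have level i : (Int (fun x => (k i.+1%:R < u x)%R%:R * w x)
    <= (m * expR (- (2 * p * i.+1%:R)))%:E)%E.
  elim: i => [|i ih].
    apply: le_trans _ Iw; apply: ge0_le_integral => //.
    - by move=> x Dx; rewrite lee_fin mulr_ge0 ?w0.
    - by apply/measurable_EFinP; exact: mgt.
    - exact/measurable_EFinP.
    - by move=> x Dx; rewrite lee_fin ler_piMl ?w0// lern1 leq_b1.
  have z1 : 1 <= i.+1%:R :> R by rewrite ler1n.
  have -> : i.+2%:R = i.+1%:R + 1 :> R by rewrite natr1.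
  move: (i.+1%:R : R) z1 ih => z z1 ih.
  have z0 : 0 < z by exact: lt_le_trans z1.
  have dk : c' * M * (q * z `^ (- theta)) <= k (z + 1) - k z.
    have -> : k (z + 1) - k z = c' * M * (z `^ (- eps) - (z + 1) `^ (- eps)).
      by rewrite /k; ring.
    by rewrite (ler_pM2l (mulr_gt0 c'0 M0)) /q thetaE powRN_decrement.
  have dk0 : 0 < k (z + 1) - k z.
    apply: lt_le_trans dk; exact: mulr_gt0 (mulr_gt0 c'0 M0) (mulr_gt0 q0 (powR_gt0 _ z0)).
  have kz0 : 0 <= k z.
    rewrite (mulr_ge0 (ltW (mulr_gt0 c'0 M0)))// subr_ge0.
    by rewrite -[leRHS](powRr0 z) ler_powR// oppr_le0 ltW.
  have kk : k z < k (z + 1) by rewrite -subr_gt0.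
  apply: le_trans (step _ _ _ kz0 kk z1 ih) _; rewrite lee_fin.
  have -> : m * expR (- (2 * p * (z + 1))) = (mp * (expR (- (2 * z)) * expR (- 2))) `^ p.
    rewrite powRM ?mulr_ge0 ?expR_ge0 ?(ltW mp0)// powRVK ?gt_eqF ?(ltW m0)//.
    by rewrite -expRD -expRM; congr (_ * expR _); ring.
  apply: ler_wpowR; first exact: ltW.
    apply: divr_ge0; last by rewrite ltW// divr_gt0.
    by rewrite !mulr_ge0 ?expR_ge0 ?powR_ge0 ?(ltW c0) ?(ltW M0).
  rewrite ler_pdivrMr; last by rewrite divr_gt0.
  set X := expR (- (2 * z)); have X0 : 0 < X by exact: expR_gt0.
  have dk' := ler_wpM2l (ltW (mulr_gt0 mp0 (mulr_gt0 X0 (expR_gt0 (- 2))))) dk.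
  apply: (@le_trans _ _ (mp * (X * expR (- 2)) * (c' * M * (q * z `^ (- theta))) / 2)).
    rewrite le_eqVlt; apply/orP; left; apply/eqP.
    by rewrite /c' expRN; field; rewrite !gt_eqF ?expR_gt0.
  by rewrite [leRHS]mulrA ler_pM2r.
(* All levels stay below [c' M], so the measure of [u > c' M] is at most
   [m exp (-2 p (i + 1)) <= m / (i + 1)] for every [i]. *)
apply/lee_addgt0Pr => r r0; rewrite add0e.
have [i ir] := ltr_add_invr (divr_gt0 r0 m0); rewrite add0r ltr_pdivlMr// in ir.
have Hi : (\int[mu]_(x in D) ((c' * M < u x)%R%:R * w x)%:E
    <= \int[mu]_(x in D) ((k i.+1%:R < u x)%R%:R * w x)%:E)%E.
  apply: ge0_le_integral => //.
  - by move=> x Dx; rewrite lee_fin mulr_ge0 ?w0.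
  - by apply/measurable_EFinP; exact: mgt.
  - by apply/measurable_EFinP; exact: mgt.
  - move=> x Dx; rewrite lee_fin ler_wpM2r ?w0// ler_nat.
    have [ux|//] := ltP (c' * M) (u x).
    suff -> : k i.+1%:R < u x by [].
    apply: le_lt_trans ux; rewrite -[leRHS]mulr1 /k.
    by rewrite (ler_pM2l (mulr_gt0 c'0 M0)) gerBl powR_ge0.
apply: le_trans Hi (le_trans (level i) _).
rewrite lee_fin; apply: ltW; apply: le_lt_trans ir.
rewrite mulrC ler_pM2r// expRN lef_pV2 ?posrE ?expR_gt0//.
rewrite (le_trans _ (expR_ge1Dx _))//.
have : 1 <= i.+1%:R :> R by rewrite ler1n.
by move: (i.+1%:R : R) => z z1; nra.
Qed.

End level_sets.

(** * Sub- and supersolutions *)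

Lemma cvge0_lt (R : realType) (a : nat -> \bar R) : a j @[j --> \oo] --> 0%E ->
  forall e : R, 0 < e -> \forall j \near \oo, (a j < e%:E)%E.
Proof.
move=> /fine_cvgP[fin a0] e e0.
move/cvgrPdist_lt : a0 => /(_ _ e0); apply: filterS2 fin => j finj.
rewrite sub0r normrN => h; rewrite -(fineK finj) lte_fin.
exact: le_lt_trans (ler_norm _) h.
Qed.

(** No integrability is assumed: when both parts of [e] are infinite, the left side is [-oo] and the
    right side [+oo]. *)
Lemma integralN_le d (T : measurableType d) (R : realType) (mu : {measure set T -> \bar R})
    (D : set T) (e : T -> R) :
  (\int[mu]_(x in D) (- e x)%:E <= - \int[mu]_(x in D) (e x)%:E)%E.
Proof.
rewrite [X in (X <= _)%E]integralE [X in (_ <= - X)%E]integralE.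
rewrite (_ : (fun x => (- e x)%:E) = (\- (EFin \o e))%E) ?funeposN ?funenegN//.
have := integral_ge0 mu (D := D) (fun x _ => funepos_ge0 (EFin \o e) x).
have := integral_ge0 mu (D := D) (fun x _ => funeneg_ge0 (EFin \o e) x).
rewrite /comp; case: (integral mu D _) => [r| |]; case: (integral mu D _) => [s| |] //= _ _.
by rewrite lee_fin opprB.
Qed.

Section bounded_solutions.
Context (R : realType) (n : nat).
Local Notation V := 'rV[R]_n.+1.
Implicit Types (Omega : set V) (v u f g h phi : V -> R) (G t : V -> V) (Q : V -> 'M[R]_n.+1).

Lemma Linfty_norm_le Omega v h (K : R) : measurable Omega -> weight Omega v ->
  measurable_fun Omega h -> 0 <= K ->
  (\int[leb]_(x in Omega) ((K < `|h x|)%R%:R * v x)%:E <= 0)%E ->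
  (Linfty_norm Omega v h <= K%:E)%E.
Proof.
move=> mO [mv v0] mh K0 I0; apply: ereal_inf_lbound; split; first by rewrite lee_fin.
have mA : measurable (Omega `&` (fun x => `|h x|) @^-1` `]K, +oo[).
  by apply: (measurable_fun_norm mh mO); exact: measurable_itv.
exists (Omega `&` (fun x => `|h x|) @^-1` `]K, +oo[); split => //.
  rewrite /wmeas setIA setIid integral_mkcondr.
  apply/eqP; rewrite eq_le; apply/andP; split; last first.
    apply: integral_ge0 => x Ox; rewrite patchE; case: ifP => _ //.
    by rewrite lee_fin v0.
  apply: le_trans I0; rewrite le_eqVlt; apply/orP; left; apply/eqP.
  apply: eq_integral => x _; rewrite patchE /= preimage_itvoy.
  have [Kh|hK] := ltP K `|h x|.
    by rewrite mem_set// mul1r.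
  by rewrite memNset ?mul0r//= ltNge hK.
move=> x /= nP; have [Ox|nOx] := pselect (Omega x); last by exfalso; apply: nP.
split => //=; rewrite in_itv /= andbT ltNge; apply/negP => hK.
by apply: nP => _; rewrite lee_fin.
Qed.

Lemma integral_norm_level_le0 Omega v u (K : R) : measurable Omega -> weight Omega v ->
  measurable_fun Omega u ->
  (\int[leb]_(x in Omega) ((K < u x)%R%:R * v x)%:E <= 0)%E ->
  (\int[leb]_(x in Omega) ((K < - u x)%R%:R * v x)%:E <= 0)%E ->
  (\int[leb]_(x in Omega) ((K < `|u x|)%R%:R * v x)%:E <= 0)%E.
Proof.
move=> mO [mv v0] mu I1 I2.
have mlevel w : measurable_fun Omega w ->
    measurable_fun Omega (fun x => (K < w x)%R%:R * v x).
  move=> mw; have mb := @measurable_fun_bool_real _ _ R _ _ (measurable_gt K mw).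
  exact: (measurable_funM mb mv).
have pos (P : V -> bool) x : Omega x -> 0 <= (P x)%:R * v x.
  by move=> Ox; rewrite mulr_ge0 ?v0.
have -> : 0%E = (1 * 0 + 1 * 0)%R%:E :> \bar R by rewrite mulr0 addr0.
refine (integral_le_lincomb mO (mlevel _ (measurable_fun_norm mu)) (mlevel _ mu)
  (mlevel _ (measurable_funN mu)) (pos _) (pos _) (pos _) ler01 ler01 _ I1 I2).
move=> x Ox; rewrite !mul1r -mulrDl ler_wpM2r ?v0// -natrD ler_nat.
by rewrite ltr_normr; case: (K < u x); case: (K < - u x).
Qed.

Lemma in_QLpN Omega Q (p : R) G : in_QLp Omega Q p G ->
  in_QLp Omega Q p (fun x => - G x).
Proof.
move=> [mG fin]; split.
  move=> i; apply: eq_measurable_fun (measurable_funN (mG i)) => x _.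
  by rewrite mxE.
suff -> : QLp_norm Omega Q p (fun x => - G x) = QLp_norm Omega Q p G by exact: fin.
rewrite /QLp_norm; apply: (f_equal (fun a => a `^ p^-1)%E).
by apply: eq_integral => x _; rewrite mxactN enormN.
Qed.

Lemma Orlicz_norm_ge0 Omega v (Phi : R -> R) h : (0 <= Orlicz_norm Omega v Phi h)%E.
Proof. by apply: le_ereal_inf_tmp => _ [l [l0 _] <-]; rewrite lee_fin ltW. Qed.

Lemma normr_pow_sign (p w : R) : 1 < p -> `|pow_sign p w| = `|w| `^ (p - 1).
Proof.
by move=> p1; rewrite /pow_sign normrM ger0_norm ?powR_ge0// powR_subr2M.
Qed.

Lemma normr_data_form_le Omega v (p : R) t f g phi : 1 < p -> measurable Omega ->
  weight Omega v -> measurable_fun Omega f -> measurable_fun Omega g ->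
  measurable_vf Omega t -> Lip0 Omega phi -> (forall x, 0 <= phi x) ->
  (`|data_form Omega p v t f g phi| <= data_bound Omega v p t f g phi)%E.
Proof.
move=> p1 mO [mv v0] mf mg mt Lphi phi0.
have mphi := Lip0_measurable Lphi.
have mT := measurable_dot mt (measurable_grad Lphi).
have mps h : measurable_fun Omega h -> measurable_fun Omega (fun x => pow_sign p (h x)).
  by move=> mh; exact: (measurable_funM (measurable_fun_powRl _ (measurable_fun_norm mh)) mh).
have m1 := measurable_funM (measurable_funD (measurable_funM (mps _ mf) mphi)
  (measurable_funM (mps _ mg) mT)) mv.
have m2 := measurable_funM (measurable_funD
  (measurable_funM (measurable_fun_powRl (p - 1) (measurable_fun_norm mf)) mphi)
  (measurable_funM (measurable_fun_powRl (p - 1) (measurable_fun_norm mg))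
    (measurable_fun_norm mT))) mv.
have em1 := (measurable_EFinP _ _).2 m1; have em2 := (measurable_EFinP _ _).2 m2.
apply: le_trans (le_abse_integral leb mO em1) _.
apply: (ge0_le_integral leb mO _ _ em2).
- by move=> x Ox; exact: abse_ge0.
- exact: (measurableT_comp (@abse_measurable R setT) em1).
move=> x Ox /=; rewrite lee_fin normrM (ger0_norm (v0 x Ox)) ler_wpM2r ?v0//.
apply: le_trans (ler_normD _ _) _.
rewrite (normrM (pow_sign p (f x))) (normrM (pow_sign p (g x)) (dot _ _)).
by rewrite !normr_pow_sign// (ger0_norm (phi0 x)).
Qed.

Lemma in_QLp_bound Omega (p : R) Q G : 1 < p -> in_QLp Omega Q p G ->
  exists g0 : R, (\int[leb]_(x in Omega) (sqrtQ_norm Q G x `^ p)%:E <= g0%:E)%E.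
Proof.
move=> p1 [mG fin]; exists (fine (QLp_norm Omega Q p G) `^ p).
have p0 : 0 < p by exact: lt_trans p1.
have q0 : (0 <= QLp_norm Omega Q p G)%E by exact: poweR_ge0.
rewrite -le_poweRV ?fine_ge0//; last first.
  by apply: integral_ge0 => x Ox; rewrite lee_fin powR_ge0.
by rewrite fineK// ge0_fin_numE.
Qed.

(** * The one-sided bound, with a constant independent of the solution *)

Section upper_bound.
Context (Omega : set V) (p sigma alpha beta S Ct : R) (v : V -> R) (t : V -> V).
Hypotheses (oO : open Omega) (p1 : 1 < p) (wv : weight Omega v).
Hypotheses (iv : leb.-integrable Omega (EFin \o v)) (psigma : p < sigma).
Hypotheses (halpha : p * (p - 1) / sigma < alpha) (hbeta : p / (sigma - p) < beta).
Hypotheses (S0 : 0 < S) (Ct0 : 0 < Ct).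

(* Sub- and supersolutions are both instances, the latter through
   [(- u, - G, - psi)]. *)
Definition upper_energy_bound Q f g u G :=
  exists psi : nat -> V -> R,
    [/\ forall j, Lip0 Omega (psi j),
        Lp_norm Omega v p (fun x => psi j x - u x) @[j --> \oo] --> 0%E,
        QLp_norm Omega Q p (fun x => grad (psi j) x - G x) @[j --> \oo] --> 0%E &
        forall phi, Lip0 Omega phi -> (forall x, 0 <= phi x) ->
          (energy_form Omega p Q G phi <= data_bound Omega v p t f g phi)%E].

Lemma level_set_null : exists2 c : R, 0 < c &
  forall Q, measurable_mxf Omega Q -> (forall x, Omega x -> sym_nonneg (Q x)) ->
    subunit Omega v Q p t Ct -> sobolev Omega v Q p (log_bump p sigma) S ->
  forall f g (M : R), measurable_fun Omega f -> measurable_fun Omega g ->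
    (Orlicz_norm Omega v (exp_bump alpha) f < M%:E)%E ->
    (Orlicz_norm Omega v (exp_bump beta) g < M%:E)%E -> 0 < M ->
  forall u G, measurable_fun Omega u -> in_QLp Omega Q p G ->
    upper_energy_bound Q f g u G ->
    (\int[leb]_(x in Omega) ((c * M < u x)%R%:R * v x)%:E <= 0)%E.
Proof.
have mO := rV_open_measurable oO; have [mv v0] := wv.
have p0 : 0 < p by exact: lt_trans p1.
have sigma0 : 0 < sigma by exact: lt_trans psigma.
have alpha0 : 0 < alpha.
  by apply: le_lt_trans halpha; rewrite divr_ge0 ?mulr_ge0 ?subr_ge0 ?ltW.
have beta0 : 0 < beta.
  by apply: le_lt_trans hbeta; rewrite divr_ge0 ?subr_ge0 ?ltW.
have alphaP : (p - 1) / alpha <= sigma / p.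
  have : p * (p - 1) <= alpha * sigma by rewrite -ler_pdivrMr// ltW.
  by rewrite ler_pdivrMr// mulrAC ler_pdivlMr//; lra.
(* A restatement of [hbeta]: [1 / beta < (sigma - p) / p]. *)
have theta1 : 1 < sigma / p - beta^-1.
  rewrite ltrBrDr -ltrBrDl.
  have -> : sigma / p - 1 = (sigma - p) / p by field; rewrite gt_eqF.
  rewrite -[ltRHS]invf_div ltf_pV2 ?posrE ?divr_gt0 ?subr_gt0//.
pose I := fine (\int[leb]_(x in Omega) (v x)%:E)%E.
have II : (\int[leb]_(x in Omega) (v x)%:E)%E = I%:E.
  by rewrite fineK//; exact: integrable_fin_num.
have I0 : 0 <= I by rewrite fine_ge0//; apply: integral_ge0 => x Ox; rewrite lee_fin v0.
(* At [z = 1] the bound [m exp (-2 p)] is the total mass plus 1, so the iteration starts for free;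
   the added 1 keeps [m] positive when the mass is 0. *)
pose m := (I + 1) * expR (2 * p * 1).
have m0 : 0 < m by rewrite mulr_gt0 ?expR_gt0// ltr_wpDl.
have Im : (\int[leb]_(x in Omega) (v x)%:E <= (m * expR (- (2 * p * 1)))%:E)%E.
  by rewrite II lee_fin /m -mulrA -expRD subrr expR0 mulr1 lerDl.
(* The one-step estimate is taken with [2 * m], since it is applied to [psi j], whose level sets may
   be twice as large as those of [u]. *)
have m20 : 0 < 2 * m by rewrite mulr_gt0.
have [c1 c10 Hone] := trunc_Lp_decay mO wv p1 sigma0 alpha0 beta0 alphaP S0 m20 Ct0.
have [c c0 Hiter] := level_iteration leb mO mv v0 p1 m0 c10 theta1.
exists c => // Q mQ symQ subu sob f g M mf mg fM gM M0 u G mu iG.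
move=> [psi [Lpsi cvgu cvgG Hen]].
have mpsi j := Lip0_measurable (Lpsi j).
apply: Hiter => //.
have [g0 IG] := in_QLp_bound p1 iG.
pose K z := c1 * (M * z `^ (- (sigma / p - beta^-1)) * expR (- (2 * z))).
have K0 z : 1 <= z -> 0 <= K z.
  by move=> z1; rewrite !mulr_ge0 ?powR_ge0 ?expR_ge0 ?(ltW c10) ?(ltW M0).
refine (@level_decay _ _ _ leb _ mO _ mv v0 _ _ K _ _ p0 m0 K0 mu mpsi _ _).
  move=> e e0; have := cvge0_lt cvgu e0; apply: filterS => j /ltW.
  rewrite /Lp_norm le_poweRV ?(ltW e0)//.
  by apply: integral_ge0 => x Ox; rewrite lee_fin mulr_ge0 ?powR_ge0 ?v0.
move=> k z k0 z1; have z0 : 0 < z by exact: lt_le_trans z1.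
have kappa0 : 0 < M * z `^ beta^-1 * expR (- (2 * z)).
  by rewrite !mulr_gt0 ?powR_gt0 ?expR_gt0.
have := cvge0_lt cvgG kappa0; apply: filterS => j /ltW.
rewrite /QLp_norm le_poweRV ?(ltW kappa0)//; last first.
  by apply: integral_ge0 => x Ox; rewrite lee_fin powR_ge0.
move=> ID Ik.
exact: (Hone Q t (psi j) G k f g M z g0 mQ symQ sob subu mf mg fM gM M0 (Lpsi j)
  (proj1 iG) k0 z1 IG ID (Hen _ (Lip0_trunc k0 (Lpsi j)) (trunc_ge0 _ _)) Ik).
Qed.

End upper_bound.

Section weak_solutions.
Context (Omega : set V) (p : R) (v : V -> R) (Q : V -> 'M[R]_n.+1) (t : V -> V) (f g : V -> R).
Hypotheses (p1 : 1 < p) (mO : measurable Omega) (wv : weight Omega v).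
Hypotheses (mf : measurable_fun Omega f) (mg : measurable_fun Omega g).
Hypothesis mt : measurable_vf Omega t.

Lemma subsolution_upper_bound u G : weak_subsolution Omega p v Q t f g u G ->
  upper_energy_bound Omega p v t Q f g u G.
Proof.
move=> [[_ _ [psi [Lpsi cvgu cvgG]]] sub]; exists psi; split => // phi Lphi phi0.
apply: le_trans (sub _ Lphi phi0) _; apply: le_trans (lee_abs _) _.
exact: normr_data_form_le.
Qed.

(** The energy form is odd in [G], so the inequality for [G] reverses for [- G]; the sign this puts
    on the data is lost in [data_bound]. *)
Lemma supersolution_lower_bound u G : weak_supersolution Omega p v Q t f g u G ->
  upper_energy_bound Omega p v t Q f g (fun x => - u x) (fun x => - G x).
Proof.
move=> [[_ _ [psi [Lpsi cvgu cvgG]]] sup].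
have eu j : Lp_norm Omega v p (fun x => - psi j x - - u x)
    = Lp_norm Omega v p (fun x => psi j x - u x).
  rewrite /Lp_norm; apply: (f_equal (fun a => a `^ p^-1)%E).
  by apply: eq_integral => x _; rewrite -normrN opprD !opprK.
have eG j : QLp_norm Omega Q p (fun x => grad (fun y => - psi j y) x - - G x)
    = QLp_norm Omega Q p (fun x => grad (psi j) x - G x).
  rewrite /QLp_norm; apply: (f_equal (fun a => a `^ p^-1)%E).
  by apply: eq_integral => x _; rewrite gradN -enormN -mxactN opprD !opprK.
exists (fun j x => - psi j x); split.
- by move=> j; exact: Lip0N.
- by rewrite (funext eu).
- by rewrite (funext eG).
move=> phi Lphi phi0.
have -> : energy_form Omega p Q (fun x => - G x) phi =
    (\int[leb]_(x in Omega) (- (enorm (mxact (sqrtmx (Q x)) (G x)) `^ (p - 2)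
       * dot (grad phi x) (mxact (Q x) (G x))))%:E)%E.
  by apply: eq_integral => x _; rewrite !mxactN enormN dotNr mulrN.
apply: le_trans (integralN_le _ _ _) _.
have h := sup _ Lphi phi0; rewrite -leeN2 in h; apply: le_trans h _.
apply: le_trans (lee_abs _) _; rewrite abseN.
exact: normr_data_form_le.
Qed.

End weak_solutions.
End bounded_solutions.

Unset Implicit Arguments.

Theorem theorem1p3 (R : realType) (n : nat) (Omega : set 'rV[R]_n.+1)
    (p sigma alpha beta S_N Ct : R)
    (v : 'rV[R]_n.+1 -> R) (t : 'rV[R]_n.+1 -> 'rV[R]_n.+1)
    (hOmega : bounded_domain Omega) (hp : 1 < p)
    (hv : weight Omega v) (hv1 : leb.-integrable Omega (EFin \o v))
    (hsigma : p < sigma)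
    (halpha : p * (p - 1) / sigma < alpha)
    (hbeta : p / (sigma - p) < beta) :
  exists2 C : R, 0 < C &
    forall (Q : 'rV[R]_n.+1 -> 'M[R]_n.+1) (k : R),
      measurable_mxf Omega Q ->
      (forall x, Omega x -> sym_nonneg (Q x)) ->
      {ae leb, forall x, Omega x -> opnorm (Q x) `^ (p / 2) <= k * v x} ->
      subunit Omega v Q p t Ct ->
      sobolev Omega v Q p (log_bump p sigma) S_N ->
    forall f g : 'rV[R]_n.+1 -> R,
      in_Orlicz Omega v (exp_bump alpha) f ->
      in_Orlicz Omega v (exp_bump beta) g ->
    forall (u : 'rV[R]_n.+1 -> R) (G : 'rV[R]_n.+1 -> 'rV[R]_n.+1),
      let bound := (C%:E * (Orlicz_norm Omega v (exp_bump alpha) f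
                            + Orlicz_norm Omega v (exp_bump beta) g))%E in
      [/\ weak_subsolution Omega p v Q t f g u G ->
            (Linfty_norm Omega v (u^\+)%R <= bound)%E,
          weak_supersolution Omega p v Q t f g u G ->
            (Linfty_norm Omega v (u^\-)%R <= bound)%E &
          weak_solution Omega p v Q t f g u G ->
            in_Linfty Omega v u /\ (Linfty_norm Omega v u <= bound)%E].
Proof.
have [oO _ _ _] := hOmega; have mO := rV_open_measurable oO.
have [mv v0] := hv.
(* With [Ct <= 0] no field is subunit, and any constant will do. *)
have [Ct0|Ct0] := ltP 0 Ct; last first.
  exists 1 => // Q k _ _ _ [_ Ct1 _].
  by have := lt_le_trans Ct1 Ct0; rewrite ltxx.
(* [S_N] may be nonpositive; enlarging it preserves the Sobolev inequality. *)
pose S := Num.max S_N 1; have S0 : 0 < S by rewrite lt_max ltr01 orbT.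
have [c c0 Hc] := level_set_null t oO hp hv hv1 hsigma halpha hbeta S0 Ct0.
exists c => // Q k mQ symQ _ subu sobN f g [mf ff] [mg fg] u G bound.
have sob : sobolev Omega v Q p (log_bump p sigma) S.
  move=> phi Lphi; apply: le_trans (sobN _ Lphi) _.
  by apply: lee_wpmul2r; [exact: poweR_ge0|rewrite lee_fin le_max lexx].
have mt : measurable_vf Omega t by case: subu.
have a0 := Orlicz_norm_ge0 Omega v (exp_bump alpha) f.
have b0 := Orlicz_norm_ge0 Omega v (exp_bump beta) g.
have finE (x : \bar R) : (0 <= x)%E -> (x < +oo)%E -> exists2 r : R, 0 <= r & x = r%:E.
  by case: x => [r|//|//]; rewrite lee_fin => r0 _; exists r.
have [a aa0 aE] := finE _ a0 ff; have [b bb0 bE] := finE _ b0 fg.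
have boundE : bound = (c * (a + b))%:E by rewrite /bound aE bE -EFinD -EFinM.
(* The level set estimate needs [M > 0] strictly above both norms: [M = a + b + e / c] qualifies
   even when both norms are 0, and [e] tends to 0 in the end. *)
have level w F e : measurable_fun Omega w -> in_QLp Omega Q p F ->
    upper_energy_bound Omega p v t Q f g w F -> 0 < e ->
    (\int[leb]_(x in Omega) ((c * (a + b) + e < w x)%R%:R * v x)%:E <= 0)%E.
  move=> mw iF wF e0; have ec : 0 < e / c by rewrite divr_gt0.
  have -> : c * (a + b) + e = c * (a + b + e / c) by field; rewrite gt_eqF.
  apply: (Hc Q mQ symQ subu sob f g _ mf mg _ _ _ w F mw iF wF).
  - by rewrite aE lte_fin; lra.
  - by rewrite bE lte_fin; lra.
  - by lra.
have K0 e : 0 < e -> 0 <= c * (a + b) + e.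
  by move=> e0; rewrite addr_ge0 ?mulr_ge0 ?addr_ge0 ?(ltW c0) ?(ltW e0).
have upper F : weak_subsolution Omega p v Q t f g u F -> forall e, 0 < e ->
    (\int[leb]_(x in Omega) ((c * (a + b) + e < u x)%R%:R * v x)%:E <= 0)%E.
  move=> sub e; have [[[mu _] iF _] _] := sub; 
  exact: (level u F e mu iF (subsolution_upper_bound hp mO hv mf mg mt sub)).
have lower F : weak_supersolution Omega p v Q t f g u F -> forall e, 0 < e ->
    (\int[leb]_(x in Omega) ((c * (a + b) + e < - u x)%R%:R * v x)%:E <= 0)%E.
  move=> sup e; have [[[mu _] iF _] _] := sup.
  have mNu : measurable_fun Omega (fun x => - u x) by exact: measurable_funN.
  exact: (level _ _ e mNu (in_QLpN iF) (supersolution_lower_bound hp mO hv mf mg mt sup)).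
have mu_of F : QH0 Omega v Q p u F -> measurable_fun Omega u by move=> [[]].
have maxE (K y : R) : 0 <= K -> (K < `|Num.max y 0|) = (K < y).
  move=> K1; rewrite ger0_norm ?le_max ?lexx ?orbT// lt_max.
  by rewrite [K < 0]ltNge K1 orbF.
have bounded : weak_solution Omega p v Q t f g u G -> (Linfty_norm Omega v u <= bound)%E.
  move=> [qh sol]; have mu := mu_of _ qh.
  have sub : weak_subsolution Omega p v Q t f g u G.
    by split => // phi Lphi _; rewrite sol.
  have sup : weak_supersolution Omega p v Q t f g u G.
    by split => // phi Lphi _; rewrite sol.
  rewrite boundE; apply/lee_addgt0Pr => e e0; rewrite -EFinD.
  apply: Linfty_norm_le => //; first exact: K0.
  exact: (integral_norm_level_le0 mO hv mu (upper _ sub e e0) (lower _ sup e e0)).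
split.
- move=> sub; rewrite boundE; apply/lee_addgt0Pr => e e0; rewrite -EFinD.
  have mu := mu_of _ (proj1 sub).
  apply: Linfty_norm_le => //; [exact: measurable_funrpos|exact: K0|].
  apply: le_trans (upper _ sub e e0); rewrite le_eqVlt; apply/orP; left; apply/eqP.
  by apply: eq_integral => x _; rewrite maxE ?K0.
- move=> sup; rewrite boundE; apply/lee_addgt0Pr => e e0; rewrite -EFinD.
  have mu := mu_of _ (proj1 sup).
  apply: Linfty_norm_le => //; [exact: measurable_funrneg|exact: K0|].
  apply: le_trans (lower _ sup e e0); rewrite le_eqVlt; apply/orP; left; apply/eqP.
  by apply: eq_integral => x _; rewrite maxE ?K0.
- move=> sol; split; last exact: bounded.
  split; first exact: mu_of (proj1 sol).
  by apply: le_lt_trans (bounded sol) _; rewrite boundE ltry.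
Qed.
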